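(* Let $X$ be an L-embedded Banach space and $M$ a closed infinite dimensional subspace of $X$. Then $M$ does not have property CWO-$B$. In particular, $L_1[0,1]$ does not have property CWO-$B$.
   Context: Banach spaces are over the scalar field $\mathbb K$, where $\mathbb K=\mathbb R$ or $\mathbb K=\mathbb C$. $B_X$ and $B_X^\circ$ denote the closed and the open unit ball of a Banach space $X$. A Banach space $X$ is L-embedded if there is a linear projection $P$ on $X^{**}$ with range (the canonical image of) $X$ such that $\|x^{**}\|=\|Px^{**}\|+\|x^{**}-Px^{**}\|$ for every $x^{**}\in X^{**}$. A finite convex combination of relatively weakly open subsets of $B_X$ is a set $C=\sum_{j=1}^n\lambda_jU_j=\{\sum_{j=1}^n\lambda_ju_j: u_j\in U_j\}$, where $n\in\mathbb N$, each $U_j\subset B_X$ is open in the relative weak topology of $B_X$, $\lambda_j>0$ and $\sum_{j=1}^n\lambda_j=1$. The space $X$ has property CWO-$B$ if, for every such $C$, every $x\in C\cap B_X^\circ$ is an interior point of $C$ in the relative weak topology of $B_X$. *)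

(* Defs.v *)
From HB Require Import structures.
From mathcomp Require Import all_boot all_order all_algebra.
From mathcomp Require Import all_classical all_reals all_analysis measurable_realfun.
From mathcomp Require Import complex ring_quotient.
Import Order.TTheory GRing.Theory Num.Theory.
Import numFieldNormedType.Exports.

Set Implicit Arguments.
Unset Strict Implicit.
Unset Printing Implicit Defensive.

Local Open Scope classical_set_scope.
Local Open Scope ring_scope.

Inductive scalar_kind := RealScalars | ComplexScalars.

Definition scalars (R : realType) (k : scalar_kind) : numFieldType :=
  match k with
  | RealScalars => R
  | ComplexScalars => R[i]%C
  end.

Section scalars.
Context (R : realType) (k : scalar_kind).
Local Notation K := (scalars R k).

Definition scalar_Re : K -> R :=
  match k return scalars R k -> R with
  | RealScalars => id
  | ComplexScalars => fun z => complex.Re z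
  end.

Definition scalar_Im : K -> R :=
  match k return scalars R k -> R with
  | RealScalars => fun _ => 0
  | ComplexScalars => fun z => complex.Im z
  end.

Definition scalar_of_real : R -> K :=
  match k return R -> scalars R k with
  | RealScalars => id
  | ComplexScalars => fun x => x%:C%C
  end.

(* The norm of a [normedModType K] takes its values in [K]; [rnorm] is the same
   nonnegative number, seen in [R]. *)
Definition rnorm (V : normedModType K) (x : V) : R := scalar_Re `|x|.

End scalars.
Arguments scalar_Re {R k}.
Arguments scalar_Im {R k}.
Arguments scalar_of_real {R k}.

Section scalars_theory.
Context (R : realType) (k : scalar_kind).
Local Notation K := (scalars R k).
Implicit Types (x y : R) (z w : K).

Lemma scalar_ReK x : scalar_Re (scalar_of_real x : K) = x.
Proof. by case: k. Qed.

Lemma scalar_of_real_ge0 x : (0 <= (scalar_of_real x : K)) = (0 <= x).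
Proof. by case: k => //=; rewrite (lecR 0 x). Qed.

Lemma scalar_of_real_le x y :
  ((scalar_of_real x : K) <= scalar_of_real y) = (x <= y).
Proof. by case: k => //=; rewrite lecR. Qed.

Lemma scalar_of_realD x y :
  (scalar_of_real (x + y) : K) = scalar_of_real x + scalar_of_real y.
Proof. by case: k => //=; rewrite rmorphD. Qed.

Lemma scalar_of_realM x y :
  (scalar_of_real (x * y) : K) = scalar_of_real x * scalar_of_real y.
Proof. by case: k => //=; rewrite rmorphM. Qed.

Lemma scalar_of_real0 : (scalar_of_real 0 : K) = 0.
Proof. by case: k. Qed.

Lemma scalar_Re0 : scalar_Re (0 : K) = 0.
Proof. by rewrite -scalar_of_real0 scalar_ReK. Qed.

Lemma scalar_of_real_inj : injective (scalar_of_real : R -> K).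
Proof. by move=> x y /(congr1 scalar_Re); rewrite !scalar_ReK. Qed.

Lemma ge0_scalar_ReK z : 0 <= z -> scalar_of_real (scalar_Re z) = z.
Proof.
by move: z; case: k => //= -[a b]; rewrite lecE /= => /andP[/eqP-> _].
Qed.

Lemma ge0_scalar_Re_ge0 z : 0 <= z -> 0 <= scalar_Re z.
Proof. by move=> z0; rewrite -scalar_of_real_ge0 ge0_scalar_ReK. Qed.

Lemma ge0_scalar_Re_le z w : 0 <= z -> 0 <= w ->
  (scalar_Re z <= scalar_Re w) = (z <= w).
Proof. by move=> z0 w0; rewrite -scalar_of_real_le !ge0_scalar_ReK. Qed.

Lemma ge0_scalar_ReM z w : 0 <= z -> 0 <= w ->
  scalar_Re (z * w) = scalar_Re z * scalar_Re w.
Proof.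
move=> z0 w0; rewrite -[in LHS](ge0_scalar_ReK z0) -[in LHS](ge0_scalar_ReK w0).
by rewrite -scalar_of_realM scalar_ReK.
Qed.

Lemma ge0_scalar_ReD z w : 0 <= z -> 0 <= w ->
  scalar_Re (z + w) = scalar_Re z + scalar_Re w.
Proof.
move=> z0 w0; rewrite -[in LHS](ge0_scalar_ReK z0) -[in LHS](ge0_scalar_ReK w0).
by rewrite -scalar_of_realD scalar_ReK.
Qed.

Lemma rnormE (V : normedModType K) (x : V) : scalar_of_real (rnorm x) = `|x|.
Proof. by rewrite ge0_scalar_ReK. Qed.

Lemma rnorm0 (V : normedModType K) : rnorm (0 : V) = 0.
Proof. by rewrite /rnorm normr0 scalar_Re0. Qed.

Lemma rnorm_ge0 (V : normedModType K) (x : V) : 0 <= rnorm x.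
Proof. exact: ge0_scalar_Re_ge0. Qed.

Lemma ler_rnormD (V : normedModType K) (x y : V) :
  rnorm (x + y) <= rnorm x + rnorm y.
Proof. by rewrite -ge0_scalar_ReD// ge0_scalar_Re_le ?addr_ge0// ler_normD. Qed.

Lemma rnormZ (V : normedModType K) (a : K) (x : V) :
  rnorm (a *: x) = scalar_Re `|a| * rnorm x.
Proof. by rewrite /rnorm normrZ ge0_scalar_ReM. Qed.

Lemma rnorm0_eq0 (V : normedModType K) (x : V) : rnorm x = 0 -> x = 0.
Proof.
by move=> x0; apply/normr0_eq0; rewrite -rnormE x0 scalar_of_real0.
Qed.

End scalars_theory.

Lemma le_homogeneous (K : numFieldType) (V : lmodType K) (N : V -> K) :
  (forall x, 0 <= N x) -> (forall a x, N (a *: x) <= `|a| * N x) ->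
  forall a x, N (a *: x) = `|a| * N x.
Proof.
move=> N0 NZ a x; apply/eqP; rewrite eq_le NZ/=.
have [->|a0] := eqVneq a 0; first by rewrite normr0 mul0r N0.
have := NZ a^-1 (a *: x); rewrite scalerA mulVf// scale1r normfV.
by rewrite ler_pdivlMl ?normr_gt0.
Qed.

Section dual.
Context (R : realType) (k : scalar_kind).
Local Notation K := (scalars R k).
Variable V : normedModType K.

Definition is_dual : {pred V -> K^o} :=
  [pred f | `[< linear f /\ continuous f >]].

Lemma is_dualP (f : V -> K^o) :
  reflect (linear f /\ continuous f) (f \in is_dual).
Proof. exact: asboolP. Qed.

Lemma is_dual_submod_closed : submod_closed is_dual.
Proof.
split=> [|a f g /is_dualP[lf cf] /is_dualP[lg cg]]; apply/is_dualP; split.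
- by move=> a x y; rewrite scaler0 addr0.
- by move=> x; exact: cvg_cst.
- move=> b x y; rewrite !fctE/= lf lg /= !scalerDr !scalerA [a * b]mulrC.
  by rewrite addrACA.
- by move=> x; apply: cvgD (cg x); apply: cvgZl_tmp (cf x).
Qed.

HB.instance Definition _ :=
  GRing.isSubmodClosed.Build K (V -> K^o) is_dual is_dual_submod_closed.

Record dual : Type := Dual { dual_fun :> V -> K^o ; _ : dual_fun \in is_dual }.
HB.instance Definition _ := [isSub for dual_fun].
HB.instance Definition _ := [Choice of dual by <:].
HB.instance Definition _ := [SubChoice_isSubLmodule of dual by <:].

Implicit Types f g : dual.

Lemma dual_linear f : linear f.
Proof. by have /is_dualP[] := valP f. Qed.

Lemma dual_continuous f : continuous f.
Proof. by have /is_dualP[] := valP f. Qed.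

Definition dual_norm f : R := sup [set rnorm (f x) | x in [set x | rnorm x <= 1]].

Lemma dual_bounded f : exists2 M : R, 0 <= M & forall x, rnorm (f x) <= M * rnorm x.
Proof.
pose lf := GRing.isLinear.Build K V K^o *:%R f (@dual_linear f).
pose F : {linear V -> K^o} := HB.pack (f : V -> K^o) lf.
have /linear_bounded_continuous/linear_boundedP : continuous F.
  exact: dual_continuous.
move=> /pinfty_ex_gt0[M M0 FM]; exists (scalar_Re M).
  exact/ge0_scalar_Re_ge0/ltW.
move=> x; rewrite /rnorm -ge0_scalar_ReM ?(ltW M0)// ge0_scalar_Re_le//.
  exact: FM.
by rewrite mulr_ge0// ltW.
Qed.

Lemma dual0 f : f 0 = 0.
Proof. by have := dual_linear f (-1) 0 0; rewrite scaler0 addr0 scaleN1r addNr. Qed.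

Lemma dual_norm_has_sup f :
  has_sup [set rnorm (f x) | x in [set x | rnorm x <= 1]].
Proof.
split; first by exists (rnorm (f 0)), 0 => //=; rewrite rnorm0.
have [M M0 fM] := dual_bounded f; exists M => _ [x /= x1 <-].
by rewrite (le_trans (fM x))// ler_piMr.
Qed.

Lemma dualZ f a x : f (a *: x) = a *: f x.
Proof. by have := dual_linear f a x 0; rewrite dual0 !addr0. Qed.

Lemma dual_norm_ub f x : rnorm x <= 1 -> rnorm (f x) <= dual_norm f.
Proof.
by move=> x1; apply: sup_ubound; [exact: (dual_norm_has_sup f).2|exists x].
Qed.

Lemma dual_norm_ge0 f : 0 <= dual_norm f.
Proof.
apply: (le_trans (rnorm_ge0 (f 0))); apply: dual_norm_ub.
by rewrite rnorm0.
Qed.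

Lemma dual_norm_lub f M :
  (forall x, rnorm x <= 1 -> rnorm (f x) <= M) -> dual_norm f <= M.
Proof.
move=> fM; apply: ge_sup; first exact: (dual_norm_has_sup f).1.
by move=> _ [x /= x1 <-]; exact: fM.
Qed.

Lemma dual_normP f x : rnorm (f x) <= dual_norm f * rnorm x.
Proof.
have [->|x0] := eqVneq x 0.
  by rewrite dual0 !rnorm0 mulr0.
have nx0 : 0 < rnorm x.
  rewrite lt_neqAle rnorm_ge0 andbT eq_sym; apply: contra x0 => /eqP.
  by move=> /rnorm0_eq0 ->.
pose a : K := scalar_of_real (rnorm x)^-1.
have a0 : 0 <= a by rewrite scalar_of_real_ge0 invr_ge0 ltW.
have naE : scalar_Re `|a| = (rnorm x)^-1 by rewrite ger0_norm// scalar_ReK.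
have := @dual_norm_ub f (a *: x).
rewrite dualZ !rnormZ naE mulVf ?gt_eqF// => /(_ (lexx _)).
by rewrite ler_pdivrMl// mulrC.
Qed.

Let dual_knorm f : K := scalar_of_real (dual_norm f).

Let dual_knormD f g : dual_knorm (f + g) <= dual_knorm f + dual_knorm g.
Proof.
rewrite -scalar_of_realD scalar_of_real_le; apply: dual_norm_lub => x x1.
by rewrite (le_trans (ler_rnormD _ _))// lerD// dual_norm_ub.
Qed.

Let dual_knormZ a f : dual_knorm (a *: f) = `|a| * dual_knorm f.
Proof.
apply: le_homogeneous => [g|b g]; first by rewrite scalar_of_real_ge0 dual_norm_ge0.
rewrite /dual_knorm -(ge0_scalar_ReK (normr_ge0 b)) -scalar_of_realM.
rewrite scalar_of_real_le; apply: dual_norm_lub => x x1.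
by rewrite rnormZ ler_wpM2l ?dual_norm_ub// ge0_scalar_Re_ge0.
Qed.

Let dual_knorm0_eq0 f : dual_knorm f = 0 -> f = 0.
Proof.
rewrite -[RHS](scalar_of_real0 R k) => /scalar_of_real_inj f0.
apply/val_inj/funext => x; apply: rnorm0_eq0; apply/eqP.
by rewrite eq_le rnorm_ge0 andbT (le_trans (dual_normP f x))// f0 mul0r.
Qed.

HB.instance Definition _ := Lmodule_isNormed.Build K dual
  dual_knormD dual_knormZ dual_knorm0_eq0.

End dual.

Notation bidual V := (dual (dual V)).

Section bidual.
Context (R : realType) (k : scalar_kind).
Local Notation K := (scalars R k).
Variable V : normedModType K.

Lemma eval_is_dual (x : V) : (fun f : dual V => f x) \in @is_dual R k (dual V).
Proof.
apply/is_dualP; have evl : linear (fun f : dual V => f x) by [].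
split=> //.
pose lev := GRing.isLinear.Build K (dual V) K^o *:%R _ evl.
pose ev : {linear dual V -> K^o} := HB.pack (fun f : dual V => f x) lev.
rewrite -[X in continuous X]/(ev : dual V -> K^o).
apply: bounded_linear_continuous; apply/linear_boundedP.
exists `|x|; split=> [|M xM f]; first exact: normr_real.
have fx : `|f x| <= `|x| * `|f|.
  rewrite -!rnormE -scalar_of_realM scalar_of_real_le mulrC.
  by rewrite (le_trans (dual_normP f x))// /rnorm scalar_ReK.
by rewrite (le_trans fx)// ler_wpM2r// ltW.
Qed.

Definition canonical_embedding (x : V) : bidual V := Dual (eval_is_dual x).

Definition L_embedded : Prop :=
  exists P : {linear bidual V -> bidual V},
    [/\ forall phi, P (P phi) = P phi,
        range P = range canonical_embedding &
        forall phi, `|phi| = `|P phi| + `|phi - P phi|].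

End bidual.

Section weak_topology.
Context (R : realType) (k : scalar_kind).
Local Notation K := (scalars R k).

Definition weak (V : normedModType K) : Type := V.

HB.instance Definition _ (V : normedModType K) :=
  Topological.copy (weak V)
    (sup_topology (fun f : dual V =>
      Topological.class (initial_topology (f : V -> K^o)))).

Variable V : normedModType K.

Definition closed_unit_ball : set V := [set x | `|x| <= 1].
Definition open_unit_ball : set V := [set x | `|x| < 1].

Definition relatively_weakly_open (U : set V) : Prop :=
  exists2 W : set (weak V), open W & U = W `&` closed_unit_ball.

Definition convex_combination n (lambda : 'I_n -> K) (U : 'I_n -> set V) : set V :=
  [set x | exists2 u : 'I_n -> V,
    forall j, U j (u j) & x = \sum_(j < n) lambda j *: u j].

(* In the order of the complex numbers, [0 < lambda j] includes that
   [lambda j] is real. *)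
Definition CWO_B : Prop :=
  forall n (lambda : 'I_n -> K) (U : 'I_n -> set V),
    (forall j, 0 < lambda j) -> \sum_(j < n) lambda j = 1 ->
    (forall j, relatively_weakly_open (U j)) ->
  forall x, (convex_combination lambda U `&` open_unit_ball) x ->
  exists2 W : set V, relatively_weakly_open W &
    W x /\ W `<=` convex_combination lambda U.

End weak_topology.
Arguments CWO_B {R k} V.
Arguments L_embedded {R k} V.

Section linear_subspace.
Context (R : realType) (k : scalar_kind).
Local Notation K := (scalars R k).
Variables (X : normedModType K) (M : submodClosed X).

Record linear_subspace : Type :=
  LinearSubspace { linear_subspace_val :> X; _ : linear_subspace_val \in M }.
HB.instance Definition _ := [isSub for linear_subspace_val].
HB.instance Definition _ := [Choice of linear_subspace by <:].
HB.instance Definition _ := [SubChoice_isSubLmodule of linear_subspace by <:].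

Let subspace_norm (x : linear_subspace) : K := `|val x|.

Let ler_subspace_normD x y :
  subspace_norm (x + y) <= subspace_norm x + subspace_norm y.
Proof. exact: ler_normD. Qed.

Let subspace_normZ a x : subspace_norm (a *: x) = `|a| * subspace_norm x.
Proof. exact: normrZ. Qed.

Let subspace_norm0_eq0 x : subspace_norm x = 0 -> x = 0.
Proof. by move=> /normr0_eq0 x0; exact/val_inj. Qed.

HB.instance Definition _ := Lmodule_isNormed.Build K linear_subspace
  ler_subspace_normD subspace_normZ subspace_norm0_eq0.

End linear_subspace.

Definition infinite_dimensional (K : fieldType) (V : lmodType K) : Prop :=
  ~ exists n (e : 'I_n -> V),
      forall x, exists c : 'I_n -> K, x = \sum_(i < n) c i *: e i.

Section L1_01.
Context (R : realType) (k : scalar_kind).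
Local Notation K := (scalars R k).
Local Notation mu := (@lebesgue_measure R).
Local Notation I01 := (`[0, 1]%classic : set R).

(* Functions are defined on the whole real line, but integrability, equality
   almost everywhere and the norm only involve their values on [0, 1]. For
   complex scalars, integrability of the real and imaginary parts amounts to
   measurability together with integrability of the modulus. *)
Definition is_L1 : {pred R -> K^o} :=
  [pred f | mu.-integrable I01 (EFin \o (scalar_Re \o f)) &&
            mu.-integrable I01 (EFin \o (scalar_Im \o f))].

Let m01 : measurable (I01 : set (measurableTypeR R)). Proof. exact: measurable_itv. Qed.

Let eq_int (f g : R -> R) : f =1 g ->
  mu.-integrable I01 (EFin \o f) -> mu.-integrable I01 (EFin \o g).
Proof. by move=> /funext->. Qed.

Lemma scalar_ReMD (a z w : K) :
  scalar_Re (a * z + w) =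
  scalar_Re a * scalar_Re z - scalar_Im a * scalar_Im z + scalar_Re w.
Proof.
move: a z w; case: k => [a z w|[a b] [c d] [e f]] //=.
by rewrite /= mul0r subr0.
Qed.

Lemma scalar_ImMD (a z w : K) :
  scalar_Im (a * z + w) =
  scalar_Re a * scalar_Im z + scalar_Im a * scalar_Re z + scalar_Im w.
Proof.
move: a z w; case: k => [a z w|[a b] [c d] [e f]] //=.
by rewrite /= mulr0 mul0r !addr0.
Qed.

Let intZ (a : R) (f : R -> R) : mu.-integrable I01 (EFin \o f) ->
  mu.-integrable I01 (EFin \o (fun x => a * f x)).
Proof.
move=> fi; have := integrableZl m01 a fi.
by rewrite (_ : (fun x => _) = EFin \o (fun x => a * f x))//; apply/funext => x /=; rewrite EFinM.
Qed.

Let intD (f g : R -> R) : mu.-integrable I01 (EFin \o f) ->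
  mu.-integrable I01 (EFin \o g) ->
  mu.-integrable I01 (EFin \o (fun x => f x + g x)).
Proof.
by move=> fi gi; exact: (integrableD m01 fi gi).
Qed.

Lemma is_L1_submod_closed : submod_closed is_L1.
Proof.
split.
  have Im0 : scalar_Im (0 : K) = 0 by case: k.
  by apply/andP; split; apply: (@eq_int (fun=> 0) _ _ (integrable0 _ _)) => x;
    rewrite /= ?scalar_Re0 ?Im0.
move=> a f g /andP[fR fI] /andP[gR gI]; apply/andP; split.
  apply: eq_int
    (intD (intD (intZ (scalar_Re a) fR) (intZ (- scalar_Im a) fI)) gR) => //.
  by move=> x; rewrite /= scalar_ReMD mulNr.
apply: eq_int
  (intD (intD (intZ (scalar_Re a) fI) (intZ (scalar_Im a) fR)) gI) => //.
by move=> x; rewrite /= scalar_ImMD.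
Qed.

HB.instance Definition _ :=
  GRing.isSubmodClosed.Build K (R -> K^o) is_L1 is_L1_submod_closed.

Record L1_function : Type :=
  L1Function { L1_fun :> R -> K^o; _ : L1_fun \in is_L1 }.
HB.instance Definition _ := [isSub for L1_fun].
HB.instance Definition _ := [Choice of L1_function by <:].
HB.instance Definition _ := [SubChoice_isSubLmodule of L1_function by <:].

Implicit Types f g : L1_function.

Definition L1_null : {pred L1_function} :=
  [pred f : L1_function | `[< ae_eq mu I01 (f : R -> K^o) (cst 0) >]].

Lemma L1_nullP f : reflect (ae_eq mu I01 (f : R -> K^o) (cst 0)) (f \in L1_null).
Proof. exact: asboolP. Qed.

Lemma L1_null_submod_closed : submod_closed L1_null.
Proof.
split=> [|a f g /L1_nullP f0 /L1_nullP g0]; apply/L1_nullP.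
  exact: ae_eq_refl.
apply: filterS2 f0 g0 => x fx gx xI.
by rewrite /= !fctE fx// gx// scaler0 addr0.
Qed.

HB.instance Definition _ :=
  GRing.isSubmodClosed.Build K L1_function L1_null L1_null_submod_closed.

Definition L1_01 : Type := Quotient.quot (L1_null : zmodClosed _).
HB.instance Definition _ := GRing.Zmodule.on L1_01.

Definition L1_class f : L1_01 := \pi_(Quotient.quot (L1_null : zmodClosed _))%qT f.

Lemma L1_classP f g :
  L1_class f = L1_class g <-> ae_eq mu I01 (f : R -> K^o) (g : R -> K^o).
Proof.
rewrite /L1_class; split=> [/eqP|fg].
  rewrite -Quotient.idealrBE => /L1_nullP; apply: filterS => x + xI => /(_ xI).
  by move=> /eqP; rewrite subr_eq0 => /eqP.
apply/eqP; rewrite -Quotient.idealrBE; apply/L1_nullP; apply: filterS fg => x + xI.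
by move=> /(_ xI) fgx; apply/eqP; rewrite subr_eq0; apply/eqP; exact: fgx.
Qed.

Lemma L1_reprK (u : L1_01) : L1_class (repr u) = u.
Proof. exact: reprK. Qed.

Lemma L1_classD f g : L1_class (f + g) = L1_class f + L1_class g.
Proof. by rewrite /L1_class !piE. Qed.

Lemma L1_class0 : L1_class 0 = 0.
Proof. by rewrite /L1_class !piE. Qed.

Lemma repr_L1_class f : ae_eq mu I01 (repr (L1_class f) : R -> K^o) (f : R -> K^o).
Proof. by apply/L1_classP; rewrite L1_reprK. Qed.

Definition L1_scale (a : K) (u : L1_01) : L1_01 := L1_class (a *: repr u).

Lemma L1_classZ a f : L1_class (a *: f) = L1_scale a (L1_class f).
Proof.
apply/esym/L1_classP; apply: filterS (repr_L1_class f) => x + xI => /(_ xI) fx.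
exact: (congr1 ( *:%R a) fx).
Qed.

Let L1_scalerA a b u : L1_scale a (L1_scale b u) = L1_scale (a * b) u.
Proof. by rewrite -[u]L1_reprK -!L1_classZ scalerA. Qed.

Let L1_scale1r : left_id 1 L1_scale.
Proof. by move=> u; rewrite -[u]L1_reprK -!L1_classZ scale1r. Qed.

Let L1_scalerDr : right_distributive L1_scale +%R.
Proof.
move=> a u v; rewrite -[u]L1_reprK -[v]L1_reprK.
by rewrite -!(L1_classD, L1_classZ) scalerDr.
Qed.

Let L1_scalerDl u : {morph L1_scale^~ u : a b / a + b}.
Proof.
by move=> a b; rewrite -[u]L1_reprK -!(L1_classD, L1_classZ) scalerDl.
Qed.

HB.instance Definition _ := GRing.Zmodule_isLmodule.Build K L1_01
  L1_scalerA L1_scale1r L1_scalerDr L1_scalerDl.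

Lemma L1_measurable_rnorm f : measurable_fun I01 (fun x => rnorm (f x)).
Proof.
have /andP[/measurable_int mR /measurable_int mI] := valP f.
have {}mR : measurable_fun I01 (scalar_Re \o f) by exact/measurable_EFinP.
have {}mI : measurable_fun I01 (scalar_Im \o f) by exact/measurable_EFinP.
move: (val f : R -> K^o) mR mI; rewrite /rnorm; case: k => /= g mR mI.
  exact: measurableT_comp.
rewrite (_ : (fun x => _) =
  Num.sqrt \o (fun x => (complex.Re (g x)) ^+ 2 + (complex.Im (g x)) ^+ 2)); last first.
  by apply/funext => x; exact: (congr1 (@complex.Re R) (normc_def (g x))).
apply: measurableT_comp.
  by apply: continuous_measurable_fun; exact: sqrt_continuous.
by apply: measurable_funD; exact: measurable_funX.
Qed.

Let rnorm_le (z : K^o) : rnorm z <= `|scalar_Re z| + `|scalar_Im z|.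
Proof.
rewrite /rnorm; move: z; case: k => [z|[a b]] /=; first by rewrite normr0 addr0.
rewrite [leLHS](congr1 (@complex.Re R) (normc_def (a +i* b)%C))/= -[leRHS]ger0_norm ?addr_ge0// -sqrtr_sqr ler_sqrt ?sqr_ge0//.
by rewrite sqrrD !real_normK ?num_real// lerD2r lerDl mulrn_wge0// mulr_ge0.
Qed.

Lemma L1_integrable_rnorm f : mu.-integrable I01 (EFin \o (fun x => rnorm (f x))).
Proof.
have /andP[fR fI] := valP f.
have fRI := intD (integrable_norm fR) (integrable_norm fI).
apply: (le_integrable m01 _ _ fRI).
  by apply/measurable_EFinP; exact: L1_measurable_rnorm.
move=> x _; rewrite /= lee_fin ger0_norm ?rnorm_ge0//.
by rewrite (le_trans (rnorm_le _))// ler_norm.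
Qed.

Definition L1_norm (u : L1_01) : R := (\int[mu]_(x in I01) rnorm (repr u x))%R.

Lemma L1_norm_class f :
  L1_norm (L1_class f) = (\int[mu]_(x in I01) rnorm (f x))%R.
Proof.
rewrite /L1_norm /Rintegral; congr fine; apply: ae_eq_integral => //.
- by apply/measurable_EFinP; exact: L1_measurable_rnorm.
- by apply/measurable_EFinP; exact: L1_measurable_rnorm.
- by apply: filterS (repr_L1_class f) => x + xI => /(_ xI) /= ->.
Qed.

Lemma L1_norm_ge0 u : 0 <= L1_norm u.
Proof. by apply: Rintegral_ge0 => x _; exact: rnorm_ge0. Qed.

Let L1_knorm (u : L1_01) : K := scalar_of_real (L1_norm u).

Let L1_knormD u v : L1_knorm (u + v) <= L1_knorm u + L1_knorm v.
Proof.
rewrite /L1_knorm -scalar_of_realD scalar_of_real_le.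
rewrite -[u]L1_reprK -[v]L1_reprK -L1_classD !L1_norm_class.
rewrite -RintegralD//; [|exact: L1_integrable_rnorm..].
apply: le_Rintegral => //; first exact: L1_integrable_rnorm.
  exact: intD (L1_integrable_rnorm _) (L1_integrable_rnorm _).
by move=> x _; exact: ler_rnormD.
Qed.

Let L1_knormZ a u : L1_knorm (a *: u) = `|a| * L1_knorm u.
Proof.
rewrite /L1_knorm -[in RHS](ge0_scalar_ReK (normr_ge0 a)) -scalar_of_realM.
congr scalar_of_real; rewrite -[u]L1_reprK -[_ *: _]L1_classZ !L1_norm_class.
rewrite -RintegralZl//; last exact: L1_integrable_rnorm.
by apply: eq_Rintegral => x _; exact: rnormZ.
Qed.

Let L1_knorm0_eq0 u : L1_knorm u = 0 -> u = 0.
Proof.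
rewrite -[RHS](scalar_of_real0 R k) => /scalar_of_real_inj.
rewrite -[u]L1_reprK L1_norm_class -L1_class0 => u0; apply/L1_classP.
have iu := L1_integrable_rnorm (repr u).
have : ae_eq mu I01 (EFin \o (fun x => rnorm (repr u x))) (cst 0%E).
  apply/(ae_eq_integral_abs _ m01); first exact: measurable_int iu.
  under eq_integral do rewrite /= ger0_norm ?rnorm_ge0//.
  rewrite -[LHS]fineK; last exact: integrable_fin_num iu.
  by rewrite -[fine _]/(\int[mu]_(x in I01) rnorm (repr u x))%R u0.
by apply: filterS => x + xI => /(_ xI) [] /rnorm0_eq0.
Qed.

HB.instance Definition _ := Lmodule_isNormed.Build K L1_01
  L1_knormD L1_knormZ L1_knorm0_eq0.

End L1_01.

(* Main.v *)
Require Import Defs.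
From HB Require Import structures.
From mathcomp Require Import all_boot all_order all_algebra.
From mathcomp Require Import all_classical all_reals all_analysis.
From mathcomp Require Import measurable_realfun complex ring lra.
Import Order.TTheory GRing.Theory Num.Theory.
Import numFieldNormedType.Exports.
Local Open Scope classical_set_scope.
Local Open Scope ring_scope.
Set Implicit Arguments.
Unset Strict Implicit.
Unset Printing Implicit Defensive.

(** The argument is by contradiction. Suppose that [M] has property CWO-B, and let
[C] be the trace on its unit ball of a finite intersection of weakly open
half-spaces, containing [p]. As [0 = p / 2 + (- p) / 2], every weakly small [w] of
the unit ball is half the difference of two points [u], [v] of [C]. With
[z = (u + v) / 2], both [z + w] and [z - w] lie in [C] ([CWO_B_midpoint]), and [z]
is weakly as close to [p] as wished. Weak-star density and compactness carry this
to the bidual of [M], which is the biannihilator of [M] in the bidual of [X]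
([CWO_B_bidual_midpoint]).

First, [M] is not reflexive ([CWO_B_nonreflexive]). Since [w] may be a unit vector,
every such [C] has diameter [2], so a decreasing sequence of them can be made to
stay away from larger and larger finite subsets of the linear span of points picked
in the previous ones. A cluster point of these points that belonged to [M] would
lie in their closed linear span, and be far from a dense subset of it.

Hence the bidual of [M] contains some [y + s], with [y] in [X] and [s] a singular
element of norm [1], that is, an element of the kernel of the L-projection.
Goldstine's theorem gives elements [e] of [M - y] that converge to [s], with norms
tending to [1] ([goldstine_translate]). Apply the midpoint property to
[w = (s - e) / 2]. Writing [z = x + t] with [x] regular and [t] singular,
   [|z + w| = |x - e / 2| + |t + s / 2|], [|z - w| = |x + e / 2| + |t - s / 2|],
and the same four terms, paired differently, bound the sum of the norms of
[z + (s + e) / 2] and [z - (s + e) / 2]. In the limit, [|z + s| + |z - s| <= 2],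
which forces [z] to be singular too. So every [p] in the unit ball of [M] is
approximated by such singular [z] in the bidual of [M] ([singular_flip]).

Finally, some functionals [a], [b] on [M] satisfy
[|a + b|, |a - b| <= C < |a| + |b|] ([dual_pair]). The previous step, used once with
[p] nearly norming [a], produces a singular [s] of norm [1] in the bidual of [M]
itself, with [a (s)] close to [|a|]; used again with this [s] and with [p] nearly
norming [b], it produces [z] with [b (z)] close to [|b|]. But
   [2 a (s) + 2 b (z) = (a + b) (z + s) + (b - a) (z - s)
     <= C (|z + s| + |z - s|) <= 2 C],
a contradiction.

For [L1[0, 1]] no bidual is needed: it is the [l1]-sum of the functions supported
by either half of the interval, and a weakly small unit vector [w] supported by one
half satisfies [|z + w| + |z - w| >= 2 + 2 |z'|], where [z'] is the restriction of
[z] to the other half ([l1_sum_not_CWO_B]). *)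

(** * Real parts and moduli of scalars *)

Lemma complex_norm_le (R : realType) (a b : R) :
  complex.Re `|(a +i* b)%C| <= `|a| + `|b|.
Proof.
rewrite (congr1 (@complex.Re R) (normc_def (a +i* b)%C))/=.
rewrite -[leRHS]ger0_norm ?addr_ge0// -sqrtr_sqr ler_wsqrtr//.
by rewrite [leRHS]sqrrD !real_normK ?num_real// lerD2r lerDl mulrn_wge0// mulr_ge0.
Qed.

Section Scalars.
Context (R : realType) (k : scalar_kind).
Local Notation K := (scalars R k).
Implicit Types (x y : R) (z w : K).

Lemma scalar_ReD z w : scalar_Re (z + w) = scalar_Re z + scalar_Re w.
Proof. by move: z w; case: k => //= [[a b] [c d]]. Qed.

Lemma scalar_ReN z : scalar_Re (- z) = - scalar_Re z.
Proof. by move: z; case: k => //= [[a b]]. Qed.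

Lemma scalar_ReB z w : scalar_Re (z - w) = scalar_Re z - scalar_Re w.
Proof. by rewrite scalar_ReD scalar_ReN. Qed.

Lemma scalar_ReZ x z : scalar_Re (scalar_of_real x * z) = x * scalar_Re z.
Proof. by move: z; case: k => //= [[a b]] /=; rewrite mul0r subr0. Qed.

Lemma scalar_Re_sum (I : Type) (r : seq I) (F : I -> K) :
  scalar_Re (\sum_(i <- r) F i) = \sum_(i <- r) scalar_Re (F i).
Proof. by apply: big_morph; [exact: scalar_ReD|exact: scalar_Re0]. Qed.

Lemma scalar_of_real1 : scalar_of_real 1 = 1 :> K.
Proof. by case: k. Qed.

Lemma scalar_of_realN x : scalar_of_real (- x) = - scalar_of_real x :> K.
Proof. by case: k => //=; rewrite rmorphN. Qed.

Lemma scalar_of_real_norm x : `|scalar_of_real x : K| = scalar_of_real `|x|.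
Proof. by case: k => //=; rewrite normc_def/= expr0n/= addr0 sqrtr_sqr. Qed.

Lemma rnorm_of_real x : rnorm (scalar_of_real x : K^o) = `|x|.
Proof. by rewrite /rnorm [`|_|]scalar_of_real_norm scalar_ReK. Qed.

Lemma ler_Re_rnorm z : scalar_Re z <= rnorm (z : K^o).
Proof.
rewrite /rnorm; move: z; case: k => [z|[a b]] /=; first exact: ler_norm.
rewrite [leRHS](congr1 (@complex.Re R) (normc_def (a +i* b)%C))/=.
by rewrite (le_trans (ler_norm _))// -sqrtr_sqr ler_wsqrtr// lerDl sqr_ge0.
Qed.

(** Multiplying by a unimodular scalar turns a modulus into a real part; this is
how norm estimates on scalar-valued functionals follow from one-sided estimates
on real parts. *)
Lemma scalar_phase z : exists2 a : K, rnorm (a : K^o) = 1 &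
  scalar_Re (a * z) = rnorm (z : K^o).
Proof.
have [->|z0] := eqVneq z 0.
  by exists 1; rewrite ?mulr0 /rnorm ?normr1 ?normr0 -?scalar_of_real1 ?scalar_ReK.
exists (`|z| / z).
  by rewrite /rnorm normf_div normr_id divff ?normr_eq0// -scalar_of_real1 scalar_ReK.
by rewrite mulfVK.
Qed.

(** Moduli are controlled by two real parts, so the real parts of finitely many
functionals suffice to describe weak neighbourhoods. *)
Lemma scalar_rnorm_le : exists j : K, forall z,
  rnorm (z : K^o) <= `|scalar_Re z| + `|scalar_Re (j * z)|.
Proof.
rewrite /rnorm; case: k => /=; first by exists 0 => z; rewrite lerDl.
exists 'i%C => -[a b] /=; rewrite mul0r mul1r add0r normrN.
exact: complex_norm_le.
Qed.

End Scalars.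

(** * The Hahn-Banach theorem for real spaces *)

Section SublinearMinorants.
Context (R : realType) (V : lmodType R).
Implicit Types (p q : V -> R) (x y : V) (A : set (V * R)).

(** Only the inequalities are asked: positive homogeneity and the value at [0]
follow. *)
Definition sublinear p :=
  (forall x y, p (x + y) <= p x + p y) /\
  (forall t x, 0 < t -> p (t *: x) <= t * p x).

Definition convex_cone A :=
  [/\ A (0, 0), (forall u v, A u -> A v -> A (u.1 + v.1, u.2 + v.2)) &
      (forall t u, 0 < t -> A u -> A (t *: u.1, t * u.2))].

Lemma sublinear0 p : sublinear p -> p 0 = 0.
Proof.
move=> [_ ph].
have := ph 2 0 ltac:(lra); have := ph (2^-1) 0 ltac:(lra).
by rewrite !scaler0 => h1 h2; lra.
Qed.

Lemma sublinearN p x : sublinear p -> - p (- x) <= p x.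
Proof.
by move=> sp; have := sp.1 x (- x); rewrite subrr sublinear0// => h; lra.
Qed.

(** Lowering a sublinear function along a cone lying under its graph: the
infimal convolution stays sublinear, and now takes at [- n] a value at most
[- c] for each [(n, c)] in the cone. *)
Lemma sublinear_lower p A : sublinear p -> convex_cone A ->
  (forall u, A u -> u.2 <= p u.1) ->
  exists q, [/\ sublinear q, (forall x, q x <= p x) &
    (forall u, A u -> q (- u.1) <= - u.2)].
Proof.
move=> sp [A0 AD AZ] Ap; have p0 := sublinear0 sp.
pose E x := [set p (x + u.1) - u.2 | u in A].
have lbE x : has_lbound (E x).
  exists (- p (- x)) => _ [u Au <-]; have := Ap u Au.
  by have := sp.1 (x + u.1) (- x); rewrite addrC addKr => h1 h2; lra.
have neE x : E x !=set0 by exists (p (x + 0) - 0); exists (0, 0).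
have qle x u : A u -> inf (E x) <= p (x + u.1) - u.2.
  by move=> Au; apply: ge_inf => //; exists u.
exists (fun x => inf (E x)); split=> [|x|u Au].
- split=> [x y|t x t0].
    rewrite -lerBlDr; apply: lb_le_inf => // _ [u Au <-].
    rewrite lerBlDl -lerBlDr; apply: lb_le_inf => // _ [v Av <-].
    rewrite lerBlDl; apply: le_trans (qle _ _ (AD u v Au Av)) _ => /=.
    by have := sp.1 (x + u.1) (y + v.1); rewrite addrACA => h; lra.
  rewrite -ler_pdivrMl//; apply: lb_le_inf => // _ [u Au <-].
  rewrite ler_pdivrMl//; apply: le_trans (qle _ _ (AZ t u t0 Au)) _ => /=.
  by rewrite -scalerDr mulrBr lerD2r sp.2.
- by have := qle x _ A0; rewrite /= addr0 subr0.
- by have := qle (- u.1) u Au; rewrite addNr p0 add0r.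
Qed.

Definition linear_functional (l : V -> R) :=
  (forall x y, l (x + y) = l x + l y) /\ (forall t x, l (t *: x) = t * l x).

Lemma minimal_sublinear_linear p : sublinear p ->
  (forall q, sublinear q -> (forall x, q x <= p x) -> forall x, p x <= q x) ->
  linear_functional p.
Proof.
move=> sp pmin; have p0 := sublinear0 sp.
have pN y : p (- y) = - p y.
  apply/eqP; rewrite eq_le; apply/andP; split; last first.
    by have := sublinearN y sp => h; lra.
  (* lowering along the ray of [y] would produce a smaller function *)
  pose A := [set u | exists2 t, 0 <= t & u = (t *: y, t * p y)].
  have [|u [t t0 ->] /=|q [sq qp /(_ (y, p y))/=]] := @sublinear_lower p A sp.
  - split=> [|_ _ [s s0 ->] [t t0 ->]|s _ s0 [t t0 ->]] /=.
    + by exists 0; rewrite // scale0r mul0r.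
    + by exists (s + t); rewrite ?addr_ge0// scalerDl mulrDl.
    + by exists (s * t); rewrite ?mulr_ge0 ?(ltW s0)// scalerA mulrA.
  - have [->|tn0] := eqVneq t 0; first by rewrite mul0r scale0r p0.
    have tp : 0 < t by rewrite lt_neqAle eq_sym tn0.
    rewrite -ler_pdivlMl//; apply: le_trans (sp.2 _ _ _); last by rewrite invr_gt0.
    by rewrite scalerA mulVf// scale1r.
  - have Ay : A (y, p y) by exists 1; rewrite ?scale1r ?mul1r.
    by move=> /(_ Ay); apply: le_trans; exact: pmin.
have pD x y : p (x + y) = p x + p y.
  apply/eqP; rewrite eq_le sp.1/=; have := sp.1 (x + y) (- y).
  by rewrite addrK pN => h; lra.
have pZ t x : 0 < t -> p (t *: x) = t * p x.
  move=> t0; apply/eqP; rewrite eq_le sp.2//=; have := sp.2 t^-1 (t *: x).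
  by rewrite invr_gt0 => /(_ t0); rewrite scalerA mulVf ?gt_eqF// scale1r ler_pdivlMl.
split=> // t x; have [t0|t0|->] := ltrgtP t 0; last 1 first.
- by rewrite scale0r mul0r p0.
- rewrite -[t]opprK scaleNr pN pZ ?mulNr//; lra.
- exact: pZ.
Qed.

(** Zorn's lemma provides a minimal sublinear function below [p]. *)
Lemma linear_minorant p : sublinear p ->
  exists2 l, linear_functional l & forall x, l x <= p x.
Proof.
move=> sp; pose T := {q : V -> R | sublinear q /\ forall x, q x <= p x}.
pose t0 : T := exist _ p (conj sp (fun x => lexx _)).
pose Rel (q r : T) := `[< forall x, sval r x <= sval q x >].
have [||A tA|[q [sq qp]] qmin] := @ZL_preorder T t0 Rel.
- by move=> q; apply/asboolP.
- move=> r q s /asboolP rq /asboolP qs; apply/asboolP => x.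
  exact: le_trans (qs x) (rq x).
- have [->|/set0P[q0 Aq0]] := eqVneq A set0; first by exists t0.
  (* the pointwise infimum of a chain *)
  pose E x := [set sval q x | q in A].
  have lbE x : has_lbound (E x).
    exists (- p (- x)) => _ [[q [sq qp]] _ <-] /=.
    by apply: le_trans (sublinearN x sq); rewrite lerN2.
  have neE x : E x !=set0 by exists (sval q0 x); exists q0.
  have Ele (q : T) x : A q -> inf (E x) <= sval q x.
    by move=> Aq; apply: ge_inf => //; exists q.
  have si : sublinear (fun x => inf (E x)).
    split=> [x y|t x tp].
      rewrite -lerBlDr; apply: lb_le_inf => // _ [q Aq <-].
      rewrite lerBlDl -lerBlDr; apply: lb_le_inf => // _ [r Ar <-].
      rewrite lerBlDl; have [/asboolP h|/asboolP h] := tA _ _ Aq Ar.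
        have := Ele _ (x + y) Ar; have := (svalP r).1.1 x y; have := h x => *; lra.
      have := Ele _ (x + y) Aq; have := (svalP q).1.1 x y; have := h y => *; lra.
    rewrite -ler_pdivrMl//; apply: lb_le_inf => // _ [q Aq <-].
    rewrite ler_pdivrMl//; apply: le_trans (Ele _ _ Aq) _.
    exact: (svalP q).1.2.
  have ip x : inf (E x) <= p x.
    exact: le_trans (Ele _ _ Aq0) ((svalP q0).2 x).
  pose q1 : T := exist _ (fun x => inf (E x)) (conj si ip).
  by exists q1 => q Aq; apply/asboolP => x; exact: Ele.
exists q => //; apply: minimal_sublinear_linear => // r sr rq x.
have rp y : r y <= p y by exact: le_trans (rq y) (qp y).
pose r1 : T := exist _ r (conj sr rp).
by have /asboolP := qmin r1 (asboolT rq); exact.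
Qed.

(** The Hahn-Banach theorem in sandwich form: taking for the cone a half-line,
the graph of a functional on a subspace, or the sum of both, gives norming
functionals, extensions, and functionals separating a point from a subspace. *)
Theorem hahn_banach_sandwich p A : sublinear p -> convex_cone A ->
  (forall u, A u -> u.2 <= p u.1) ->
  exists l, [/\ linear_functional l, (forall x, l x <= p x) &
    (forall u, A u -> u.2 <= l u.1)].
Proof.
move=> sp cA Ap; have [q [sq qp qA]] := sublinear_lower sp cA Ap.
have [l ll lq] := linear_minorant sq.
exists l; split=> // [x|u Au]; first exact: le_trans (lq x) (qp x).
have := le_trans (lq _) (qA u Au).
by rewrite -scaleN1r ll.2 mulN1r lerN2.
Qed.

End SublinearMinorants.

(** * Dual spaces and the Hahn-Banach theorem over the scalar field *)

Section DualSpace.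
Context (R : realType) (k : scalar_kind).
Local Notation K := (scalars R k).
Implicit Type V : normedModType K.

Lemma rnormN V (x : V) : rnorm (- x) = rnorm x.
Proof. by rewrite /rnorm normrN. Qed.

Lemma rnormZ_real V (t : R) (x : V) :
  rnorm (scalar_of_real t *: x) = `|t| * rnorm x.
Proof. by rewrite rnormZ scalar_of_real_norm scalar_ReK. Qed.

Lemma ler_rnormB V (x y : V) : rnorm (x - y) <= rnorm x + rnorm y.
Proof. by rewrite -(rnormN y) ler_rnormD. Qed.

Lemma rnorm1_normalize V (x : V) : x != 0 ->
  rnorm (scalar_of_real (rnorm x)^-1 *: x) = 1.
Proof.
move=> x0; have nx : rnorm x != 0 by apply: contra x0 => /eqP /rnorm0_eq0 ->.
by rewrite rnormZ_real ger0_norm ?invr_ge0 ?rnorm_ge0// mulVf.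
Qed.

Lemma bounded_linear_dual V (f : V -> K^o) (C : R) : linear f ->
  (forall x, rnorm (f x) <= C * rnorm x) -> f \in @is_dual R k V.
Proof.
move=> lf fC; apply/is_dualP; split=> //.
pose l := GRing.isLinear.Build K V K^o *:%R f lf.
pose F : {linear V -> K^o} := HB.pack f l.
rewrite -[X in continuous X]/(F : V -> K^o).
apply: bounded_linear_continuous; apply/linear_boundedP.
exists (scalar_of_real `|C|).
split=> [|M CM x]; first by apply/ger0_real; rewrite scalar_of_real_ge0.
apply: (@le_trans _ _ (scalar_of_real `|C| * `|x|)); last first.
  by rewrite ler_wpM2r// ltW.
rewrite -!rnormE -scalar_of_realM scalar_of_real_le (le_trans (fC x))//.
by rewrite ler_wpM2r ?rnorm_ge0// ler_norm.
Qed.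

Lemma dualD V (f : dual V) x y : f (x + y) = f x + f y.
Proof. by have := dual_linear f 1 x y; rewrite !scale1r. Qed.

Lemma dualN V (f : dual V) x : f (- x) = - f x.
Proof. by rewrite -scaleN1r dualZ scaleN1r. Qed.

Lemma dualB V (f : dual V) x y : f (x - y) = f x - f y.
Proof. by rewrite dualD dualN. Qed.

Lemma dual_addE V (f g : dual V) x : (f + g) x = f x + g x.
Proof. by []. Qed.

Lemma dual_oppE V (f : dual V) x : (- f) x = - f x.
Proof. by []. Qed.

Lemma dual_scaleE V (a : K) (f : dual V) x : (a *: f) x = a * f x.
Proof. by []. Qed.

Lemma rnorm_dual V (f : dual V) : rnorm f = dual_norm f.
Proof. by rewrite /rnorm [`|_|]/(scalar_of_real (dual_norm f)) scalar_ReK. Qed.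

Lemma ler_Re_dual V (f : dual V) x : scalar_Re (f x) <= rnorm f * rnorm x.
Proof. by rewrite (le_trans (ler_Re_rnorm _))// rnorm_dual dual_normP. Qed.

(** By rotation, real parts suffice to bound the norm of a functional. *)
Lemma rnorm_dual_le V (f : dual V) C :
  (forall x, rnorm x <= 1 -> scalar_Re (f x) <= C) -> rnorm f <= C.
Proof.
move=> fC; rewrite rnorm_dual; apply: dual_norm_lub => x x1.
have [a a1 <-] := scalar_phase (f x).
by rewrite -[a * _](dualZ f a x) fC// rnormZ -[scalar_Re `|a|]/(rnorm (a : K^o)) a1 mul1r.
Qed.

Lemma dual_eq0 V (f : dual V) (N : set V) :
  (forall a x, N x -> N (a *: x)) -> (forall x, N x -> scalar_Re (f x) <= 0) ->
  forall x, N x -> f x = 0.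
Proof.
move=> NZ fN x Nx; apply: rnorm0_eq0; apply/eqP; rewrite eq_le rnorm_ge0 andbT.
have [a _ <-] := scalar_phase (f x).
by rewrite -[a * _](dualZ f a x) fN//; exact: NZ.
Qed.

End DualSpace.

(** A real-linear functional is the real part of a scalar-linear one, with the
same norm: over the complex numbers, [f x = r x - i r (i x)]. *)
Lemma dual_of_real_part (R : realType) (k : scalar_kind)
    (V : normedModType (scalars R k)) (r : V -> R) (C : R) :
  (forall x y, r (x + y) = r x + r y) ->
  (forall t x, r (scalar_of_real t *: x) = t * r x) ->
  (forall x, r x <= C * rnorm x) -> 0 <= C ->
  exists2 f : dual V, rnorm f <= C & forall x, scalar_Re (f x) = r x.
Proof.
move=> rD rZ rC C0.
suff [f lf fr] : exists2 f : V -> (scalars R k)^o, linear f &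
    forall x, scalar_Re (f x) = r x.
  have fC x : rnorm (f x) <= C * rnorm x.
    have [a a1 <-] := scalar_phase (f x).
    have f0 : f 0 = 0 by have := lf (-1) 0 0; rewrite scaler0 addr0 scaleN1r addNr.
    have -> : a * f x = f (a *: x) by have := lf a x 0; rewrite f0 !addr0 => ->.
    by rewrite fr (le_trans (rC _))// rnormZ -[scalar_Re `|a|]/(rnorm (a : (scalars R k)^o)) a1 mul1r.
  exists (Dual (bounded_linear_dual lf fC)) => //.
  apply: rnorm_dual_le => x x1; apply: le_trans (ler_Re_rnorm _) _.
  by apply: le_trans (fC x) _; rewrite ler_piMr.
clear rC; move: V r rD rZ; case: k => V r rD rZ /=.
  by exists r => // a x y; rewrite rD rZ.
pose f x : R[i]%C^o := (r x +i* - r ('i%C *: x))%C.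
have fD x y : f (x + y) = f x + f y.
  by rewrite /f scalerDr !rD; apply/eqP; rewrite eq_complex/= !eqxx/= opprD eqxx.
have rZ' t x : r (t%:C%C *: x) = t * r x by exact: rZ.
have fZr t x : f (t%:C%C *: x) = t%:C%C * f x.
  rewrite /f rZ'; apply/eqP; rewrite eq_complex/= !mul0r subr0 addr0 eqxx/=.
  by rewrite scalerA mulrC -scalerA rZ' mulrN.
have fi x : f ('i%C *: x) = 'i%C * f x.
  rewrite /f scalerA -expr2 sqr_i scaleN1r.
  have rN y : r (- y) = - r y.
    by have := rZ (-1) y; rewrite /= rmorphN1 scaleN1r mulN1r.
  rewrite rN opprK; apply/eqP; rewrite eq_complex/= !mul0r !mul1r.
  by rewrite !add0r ?opprK !eqxx.
exists f; last by [].
move=> a x y; rewrite fD; congr (_ + _).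
rewrite [a in LHS]complexE scalerDl fD -scalerA fi !fZr.
by rewrite mulrA -mulrDl -complexE.
Qed.

(** Complex functionals are obtained from functionals on the underlying real
space. *)
Definition realified (R : realType) (k : scalar_kind)
  (V : lmodType (scalars R k)) : Type := V.

Section Realified.
Context (R : realType) (k : scalar_kind) (V : lmodType (scalars R k)).
HB.instance Definition _ := GRing.Zmodule.on (realified V).

Let rscale (t : R) (x : realified V) : realified V := scalar_of_real t *: (x : V).

Fact realified_scalerA s t x : rscale s (rscale t x) = rscale (s * t) x.
Proof. by rewrite /rscale scalerA scalar_of_realM. Qed.

Fact realified_scale1r : left_id 1 rscale.
Proof. by move=> x; rewrite /rscale scalar_of_real1 scale1r. Qed.

Fact realified_scalerDr : right_distributive rscale +%R.
Proof. by move=> t x y; exact: scalerDr. Qed.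

Fact realified_scalerDl x : {morph rscale^~ x : s t / s + t}.
Proof. by move=> s t; rewrite /rscale scalar_of_realD scalerDl. Qed.

HB.instance Definition _ := GRing.Zmodule_isLmodule.Build R (realified V)
  realified_scalerA realified_scale1r realified_scalerDr realified_scalerDl.

End Realified.

Section HahnBanach.
Context (R : realType) (k : scalar_kind).
Local Notation K := (scalars R k).
Context (V : normedModType K).
Implicit Types (N : set V) (f : dual V) (C : R).

Lemma hahn_banach_dual C (A : set (V * R)) : 0 <= C ->
  convex_cone (A : set (realified V * R)) ->
  (forall u, A u -> u.2 <= C * rnorm u.1) ->
  exists2 f : dual V, rnorm f <= C & forall u, A u -> u.2 <= scalar_Re (f u.1).
Proof.
move=> C0 cA AC.
have sp : sublinear (fun x : realified V => C * rnorm (x : V)).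
  split=> [x y|t x t0]; first by rewrite -mulrDr ler_wpM2l// ler_rnormD.
  by rewrite [rnorm _]rnormZ_real gtr0_norm// mulrCA.
have [l [[lD lZ] lC lA]] := hahn_banach_sandwich sp cA AC.
have [f fC fl] := dual_of_real_part lD lZ lC C0.
by exists f => // u Au; rewrite fl lA.
Qed.

Definition subspace_set N := N 0 /\ forall a x y, N x -> N y -> N (a *: x + y).

Lemma subspace_setZ N a x : subspace_set N -> N x -> N (a *: x).
Proof. by move=> [N0 NP] Nx; rewrite -[_ *: _]addr0; exact: NP. Qed.

Lemma subspace_setD N x y : subspace_set N -> N x -> N y -> N (x + y).
Proof. by move=> [N0 NP] Nx Ny; rewrite -[x]scale1r; exact: NP. Qed.

Lemma hahn_banach_extension N (f0 : V -> K) C : 0 <= C -> subspace_set N ->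
  (forall a x y, N x -> N y -> f0 (a *: x + y) = a * f0 x + f0 y) ->
  (forall x, N x -> scalar_Re (f0 x) <= C * rnorm x) ->
  exists2 f : dual V, rnorm f <= C & forall x, N x -> f x = f0 x.
Proof.
move=> C0 sN f0l f0C; have [N0 NP] := sN.
have f00 : f0 0 = 0.
  by have := f0l (-1) 0 0 N0 N0; rewrite scaler0 addr0 mulN1r addNr.
have f0Z a x : N x -> f0 (a *: x) = a * f0 x.
  by move=> Nx; have := f0l a x 0 Nx N0; rewrite f00 !addr0.
pose A := [set (x, scalar_Re (f0 x)) | x in N].
have [||f fC fA] := @hahn_banach_dual C A C0.
- split=> [|_ _ [x Nx <-] [y Ny <-]|t _ t0 [x Nx <-]] /=.
  + by exists 0; rewrite // f00 scalar_Re0.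
  + exists (x + y); first exact: subspace_setD.
    by have := f0l 1 x y Nx Ny; rewrite scale1r mul1r => ->; rewrite scalar_ReD.
  + exists (scalar_of_real t *: x); first exact: subspace_setZ.
    by rewrite f0Z// scalar_ReZ.
- by move=> _ [x Nx <-]; exact: f0C.
exists f => // x Nx; have fle y : N y -> scalar_Re (f0 y) <= scalar_Re (f y).
  by move=> Ny; apply: (fA (y, _)); exists y.
apply/eqP; rewrite -subr_eq0; apply/eqP/(@rnorm0_eq0 _ _ K^o)/eqP.
rewrite eq_le rnorm_ge0 andbT; have [a _ <-] := scalar_phase (f x - f0 x).
have := fle _ (subspace_setZ (- a) sN Nx); rewrite f0Z// dualZ.
by rewrite mulrBr scalar_ReB -[_ *: _]/(- a * f x) !mulNr !scalar_ReN lerN2 subr_le0.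
Qed.

Lemma hahn_banach_separation N x (d : R) : subspace_set N -> 0 <= d ->
  (forall n, N n -> d <= rnorm (x - n)) ->
  exists f : dual V, [/\ rnorm f <= 1, (forall n, N n -> f n = 0) & d <= scalar_Re (f x)].
Proof.
move=> sN d0 xd; have [N0 NP] := sN.
pose A := [set u : V * R | exists n t, [/\ N n, 0 <= t &
  u = (scalar_of_real t *: x - n, t * d)]].
have [||f f1 fA] := @hahn_banach_dual 1 A ler01.
- split.
  + by exists 0, 0; rewrite scalar_of_real0 scale0r subrr mul0r.
  + move=> _ _ [m [s [Nm s0 ->]]] [n [t [Nn t0 ->]]] /=.
    exists (m + n), (s + t); split; rewrite ?addr_ge0//.
      exact: subspace_setD.
    by rewrite scalar_of_realD scalerDl mulrDl opprD addrACA.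
  + move=> s _ s0 [n [t [Nn t0 ->]]] /=.
    exists (scalar_of_real s *: n), (s * t); split; rewrite ?mulr_ge0 ?(ltW s0)//.
      exact: subspace_setZ.
    rewrite scalar_of_realM -scalerA -scalerBr mulrA.
    by rewrite -[s *: _]/(scalar_of_real s *: (_ : V)).
- move=> _ [n [t [Nn t0 ->]]] /=; rewrite mul1r.
  have [->|tn0] := eqVneq t 0; first by rewrite mul0r rnorm_ge0.
  have tp : 0 < t by rewrite lt_neqAle eq_sym tn0.
  have := xd _ (subspace_setZ (scalar_of_real t^-1) sN Nn).
  rewrite -(ler_pM2l tp) => /le_trans; apply.
  rewrite -{1}(gtr0_norm tp) -rnormZ_real scalerBr scalerA -scalar_of_realM.
  by rewrite divff// scalar_of_real1 scale1r.
exists f; split=> //.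
  apply: dual_eq0 => [a n|n Nn]; first exact: subspace_setZ.
  have := fA (scalar_of_real 0 *: x - n, 0 * d); rewrite mul0r.
  rewrite /= scalar_of_real0 scale0r sub0r dualN scalar_ReN.
  rewrite oppr_ge0; apply.
  by exists n, 0; rewrite mul0r scalar_of_real0 scale0r sub0r.
have := fA (scalar_of_real 1 *: x - 0, 1 * d).
rewrite mul1r scalar_of_real1 scale1r subr0; apply.
by exists 0, 1; rewrite mul1r scalar_of_real1 scale1r subr0.
Qed.

Lemma norming_functional x :
  exists2 f : dual V, rnorm f <= 1 & rnorm x <= scalar_Re (f x).
Proof.
have [||n /= ->|f [f1 _ fx]] := @hahn_banach_separation [set 0] x (rnorm x).
- by split=> // a _ _ -> ->; rewrite /= scaler0 addr0.
- exact: rnorm_ge0.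
- by rewrite subr0.
by exists f.
Qed.

End HahnBanach.

(** * Weak-star limits along ultrafilters *)

Section WeakStarLimits.
Context (R : realType) (k : scalar_kind).
Local Notation K := (scalars R k).
Context (V : normedModType K) (I : Type).
Implicit Types (U : set_system I) (phi : I -> dual V) (psi : dual V).

(** Weak-star convergence, tested on real parts: replacing [x] by its multiples
recovers the convergence of the values themselves. *)
Definition weak_star_cvg U phi psi :=
  forall x, (fun i => scalar_Re (phi i x)) @ U --> scalar_Re (psi x).

Lemma ultrafilter_bounded_cvg U (g : I -> R) (C : R) : UltraFilter U ->
  (forall i, `|g i| <= C) -> exists l : R, g @ U --> l.
Proof.
move=> UU gC; have FU : ProperFilter U by exact: ultra_proper.
have [|l [_ lU]] := @segment_compact R (- C) C (g @ U) _.
  by rewrite /=; apply: filterE => i /=; rewrite in_itv/= -ler_norml.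
exists l => B Bl; have [//|UB] := in_ultra_setVsetC (g @^-1` B) UU.
have [x [/= xB /xB]] := lU (~` B) B UB Bl; by [].
Qed.

(** The Banach-Alaoglu theorem, for ultrafilters. *)
Lemma ultrafilter_weak_star_cvg U phi C : UltraFilter U -> 0 <= C ->
  (forall i, rnorm (phi i) <= C) ->
  exists2 psi : dual V, rnorm psi <= C & weak_star_cvg U phi psi.
Proof.
move=> UU C0 phiC; have FU : ProperFilter U by exact: ultra_proper.
have phib x i : `|scalar_Re (phi i x)| <= C * rnorm x.
  have le y : scalar_Re (phi i y) <= C * rnorm y.
    by rewrite (le_trans (ler_Re_dual _ _))// ler_wpM2r ?rnorm_ge0.
  by rewrite ler_norml le lerNl -scalar_ReN -dualN (le_trans (le _))// rnormN lexx.
have [l lP] : {l : V -> R & forall x,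
    (fun i => scalar_Re (phi i x)) @ U --> l x}.
  apply: (@choice V R (fun x y => (fun i => scalar_Re (phi i x)) @ U --> y)) => x.
  exact: ultrafilter_bounded_cvg (phib x).
have uniq (g : I -> R) (a b : R) : g @ U --> a -> g @ U --> b -> a = b.
  move=> ga gb; rewrite -(cvg_lim (@Rhausdorff R) ga).
  exact: (cvg_lim (@Rhausdorff R) gb).
have [||||psi psiC psil] := @dual_of_real_part R k V l C.
- move=> x y; apply: (uniq _ _ _ (lP (x + y))).
  under eq_fun do rewrite dualD scalar_ReD.
  exact: (@cvgD _ _ _ U _ _ _ _ _ (lP x) (lP y)).
- move=> t x; apply: (uniq _ _ _ (lP (scalar_of_real t *: x))).
  under eq_fun do rewrite dualZ [_ *: _]/(_ * _) scalar_ReZ.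
  exact: (@cvgMl_tmp R I U _ _ t _ (lP x)).
- move=> x; apply: (cvgr_to_le (lP x)).
  by apply: (@filterE I U) => i; exact: le_trans (ler_norm _) (phib x i).
- exact: C0.
by exists psi => // x; rewrite psil.
Qed.

Lemma weak_star_cvgD U phi1 phi2 psi1 psi2 : Filter U ->
  weak_star_cvg U phi1 psi1 -> weak_star_cvg U phi2 psi2 ->
  weak_star_cvg U (fun i => phi1 i + phi2 i) (psi1 + psi2).
Proof.
move=> FU h1 h2 x; rewrite dual_addE scalar_ReD.
under eq_fun do rewrite dual_addE scalar_ReD.
exact: (@cvgD _ _ _ U _ _ _ _ _ (h1 x) (h2 x)).
Qed.

Lemma weak_star_cvgN U phi psi : Filter U ->
  weak_star_cvg U phi psi -> weak_star_cvg U (fun i => - phi i) (- psi).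
Proof.
move=> FU h x; rewrite dual_oppE scalar_ReN.
under eq_fun do rewrite dual_oppE scalar_ReN.
exact: (@cvgN _ _ _ U _ _ _ (h x)).
Qed.

Lemma weak_star_cvg_ge U phi psi x c : ProperFilter U ->
  weak_star_cvg U phi psi -> U [set i | c <= scalar_Re (phi i x)] ->
  c <= scalar_Re (psi x).
Proof. by move=> FU h Uc; exact: (cvgr_to_ge (h x)). Qed.

(** A sum of two norms is lower semicontinuous for the weak-star topology, being
a supremum of evaluations. *)
Lemma weak_star_cvg_rnorm2 U phi1 phi2 psi1 psi2 c : ProperFilter U ->
  weak_star_cvg U phi1 psi1 -> weak_star_cvg U phi2 psi2 ->
  (forall i, rnorm (phi1 i) + rnorm (phi2 i) <= c) ->
  rnorm psi1 + rnorm psi2 <= c.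
Proof.
move=> FU h1 h2 hc; rewrite -lerBrDr; apply: rnorm_dual_le => x x1.
rewrite lerBrDr -lerBrDl; apply: rnorm_dual_le => y y1; rewrite lerBrDl.
apply: (cvgr_to_le (cvgD (h1 x) (h2 y))).
apply: (@filterE I U) => i; apply: le_trans (hc i); apply: lerD.
  by apply: le_trans (ler_Re_dual _ _) _; rewrite ler_piMr ?rnorm_ge0.
by apply: le_trans (ler_Re_dual _ _) _; rewrite ler_piMr ?rnorm_ge0.
Qed.

Lemma weak_star_cvg_rnorm U phi psi c : ProperFilter U ->
  weak_star_cvg U phi psi -> (forall i, rnorm (phi i) <= c) -> rnorm psi <= c.
Proof.
move=> FU h hc; apply: rnorm_dual_le => x x1.
apply: (cvgr_to_le (h x)); apply: (@filterE I U) => i.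
by apply: le_trans (hc i); apply: le_trans (ler_Re_dual _ _) _; rewrite ler_piMr ?rnorm_ge0.
Qed.

End WeakStarLimits.

(** Nets indexed by the finite subsets of [D] together with a precision, replaced
by an ultrafilter on the index set. *)
Lemma finite_subsets_ultrafilter (D : eqType) :
  exists2 U : set_system (seq D * nat), UltraFilter U &
    forall d n, U [set i : seq D * nat | d \in i.1 /\ (n <= i.2)%N].
Proof.
pose B (j : seq D * nat) := [set i : seq D * nat | {subset j.1 <= i.1} /\ (j.2 <= i.2)%N].
have FB : ProperFilter (filter_from setT B).
  apply: filter_from_proper; last by move=> j _; exists j; split.
  apply: filter_from_filter; first by exists ([::], 0%N).
  move=> i j _ _; exists (i.1 ++ j.1, maxn i.2 j.2) => // l [/= sl].
  rewrite geq_max => /andP[li lj]; split; split=> // d dd; apply: sl.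
    by rewrite mem_cat dd.
  by rewrite mem_cat dd orbT.
have [U [UU sU]] := ultraFilterLemma FB.
exists U => // d n; apply: sU; exists ([:: d], n) => // i [/= si ni].
by split=> //; apply: si; rewrite mem_head.
Qed.

Lemma weak_star_cvg_approx (R : realType) (k : scalar_kind)
    (V : normedModType (scalars R k)) (U : set_system (seq V * nat))
    (phi : seq V * nat -> dual V) (psi : dual V) (C : V -> R) : Filter U ->
  (forall x n, U [set i : seq V * nat | x \in i.1 /\ (n <= i.2)%N]) ->
  (forall i x, x \in i.1 ->
    `|scalar_Re (phi i x) - scalar_Re (psi x)| <= C x * i.2.+1%:R^-1) ->
  weak_star_cvg U phi psi.
Proof.
move=> FU UP phiP x; apply/cvgrPdist_le => e e0.
have C0 : 0 < `|C x| + 1 by rewrite ltr_wpDl.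
have [n _ nP] := near_infty_natSinv_lt (PosNum (divr_gt0 e0 C0)).
apply: filterS (UP x n) => i [xi ni]; rewrite distrC.
apply: le_trans (phiP i x xi) _.
have := nP _ ni; rewrite /= ltr_pdivlMr// mulrC => /ltW; apply: le_trans.
by rewrite ler_wpM2r ?invr_ge0// (le_trans (ler_norm _))// lerDl.
Qed.

(** * Goldstine's theorem for the biannihilator of a subspace *)

(** A vector lying in every half-space that contains a bounded convex set of
[R^m] is a limit of points of that set. Otherwise the vector [c] joining a nearly
closest point [a0] of the set to [v] violates the hypothesis. *)
Lemma convex_set_approximation (R : realType) (m : nat) (A : set ('I_m -> R))
    (v : 'I_m -> R) (D : R) :
  A !=set0 -> (forall a i, A a -> `|a i| <= D) ->
  (forall a b (t : R), A a -> A b -> 0 <= t <= 1 ->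
    A (fun i => a i + t * (b i - a i))) ->
  (forall (c : 'I_m -> R) (S : R), (forall a, A a -> \sum_i c i * a i <= S) -> \sum_i c i * v i <= S) ->
  forall e : R, 0 < e -> exists2 a, A a & forall i, `|a i - v i| < e.
Proof.
move=> [a1 Aa1] AD Aconv vA e e0.
pose d a := \sum_i (v i - a i) ^+ 2; pose E := [set d a | a in A].
have d0 a : 0 <= d a by apply: sumr_ge0 => i _; exact: sqr_ge0.
have infE : has_inf E.
  by split; [exists (d a1), a1 | exists 0 => _ [a _ <-]].
have [Ie|eI] := ltP (inf E) (e ^+ 2).
  have e1 : 0 < e ^+ 2 - inf E by rewrite subr_gt0.
  have [_ [a Aa <-]] := inf_adherent e1 infE; rewrite addrC subrK => ae.
  exists a => // i; rewrite -ltr_sqr ?nnegrE ?(ltW e0)// real_normK ?num_real//.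
  apply: le_lt_trans ae; rewrite /d (bigD1 i)//= -[leLHS]addr0.
  by rewrite lerD ?sumr_ge0// => [|j _]; rewrite ?sqr_ge0// -sqrrN opprB.
exfalso; pose B : R := m%:R * (2 * D) ^+ 2.
have D0 (i : 'I_m) : 0 <= D by apply: le_trans (normr_ge0 (a1 i)) _; exact: AD.
have B0 : 0 <= B by rewrite mulr_ge0 ?sqr_ge0.
have Bq a b : A a -> A b -> \sum_i (b i - a i) ^+ 2 <= B.
  move=> Aa Ab; rewrite /B mulr_natl -[m in leRHS]card_ord -sumr_const.
  apply: ler_sum => i _; have Di := D0 i.
  rewrite -real_normK ?num_real// lerXn2r ?nnegrE ?mulr_ge0//.
  by apply: le_trans (ler_normB _ _) _; rewrite mulr_natl mulr2n lerD// AD.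
have s0 : 0 < e ^+ 2 by rewrite exprn_gt0.
move: (e ^+ 2) s0 eI => s s0 eI.
move: B B0 Bq => B B0 Bq; clear D0.
pose t := s / (2 * B + s); have Bs0 : 0 < 2 * B + s by lra.
have t0 : 0 < t by rewrite divr_gt0.
have t1 : t <= 1 by rewrite ler_pdivrMr// mul1r; lra.
have tB : t * B <= s / 2 by rewrite mulrAC ler_pdivrMr// ; nra.
have eta0 : 0 < t * s / 2 by rewrite divr_gt0// mulr_gt0.
have [_ [a0 Aa0 <-]] := inf_adherent eta0 infE => a0I.
have Ile a : A a -> inf E <= d a.
  by move=> Aa; apply: ge_inf; [exact: infE.2|exists a].
have key a : A a -> \sum_i (v i - a0 i) * (a i - a0 i) <= s / 2.
  move=> Aa; set p := \sum_i _; pose q := \sum_i (a i - a0 i) ^+ 2.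
  have := Ile _ (Aconv a0 a t Aa0 Aa (introT andP (conj (ltW t0) t1))).
  have -> : d (fun i => a0 i + t * (a i - a0 i)) = d a0 - 2 * t * p + t ^+ 2 * q.
    rewrite /d /p /q !mulr_sumr -sumrB -big_split/=; apply: eq_bigr => i _.
    ring.
  move=> h; have qB : q <= B by exact: Bq.
  have h1 : 2 * t * p <= t * s / 2 + t ^+ 2 * B.
    have : t ^+ 2 * q <= t ^+ 2 * B by rewrite ler_wpM2l// sqr_ge0.
    by move=> *; lra.
  have h2 : t ^+ 2 * B <= t * (s / 2) by rewrite expr2 -mulrA ler_wpM2l// ltW.
  have h3 : t * p <= t * (s / 2) by lra.
  by move: h3; rewrite ler_pM2l.
have := vA (fun i => v i - a0 i) (\sum_i (v i - a0 i) * a0 i + s / 2).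
have -> : \sum_i (v i - a0 i) * v i = \sum_i (v i - a0 i) * a0 i + d a0.
  rewrite /d -big_split/=; apply: eq_bigr => i _; ring.
have half a : A a -> \sum_i (v i - a0 i) * a i <=
    \sum_i (v i - a0 i) * a0 i + s / 2.
  move=> Aa; rewrite addrC -lerBlDr -sumrB.
  apply: le_trans (key a Aa); rewrite le_eqVlt; apply/orP; left; apply/eqP.
  by apply: eq_bigr => i _; ring.
by move=> /(_ half); rewrite lerD2l; have := Ile _ Aa0; lra.
Qed.

Section Biannihilator.
Context (R : realType) (k : scalar_kind).
Local Notation K := (scalars R k).
Context (X : normedModType K).
Implicit Types (N : set X) (f g : dual X) (psi phi : bidual X).

(** The bipolar of a subspace [N]: its elements are the functionals that see only
the restrictions to [N], that is, the bidual of [N] inside the bidual of [X]. *)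
Definition biannihilator N psi := forall f, (forall x, N x -> f x = 0) -> psi f = 0.

Lemma biannihilator_eq N psi f g : biannihilator N psi ->
  (forall x, N x -> f x = g x) -> psi f = psi g.
Proof.
move=> Npsi fg; apply/eqP; rewrite -subr_eq0 -dualB; apply/eqP/Npsi => x Nx.
by rewrite dual_addE dual_oppE fg// subrr.
Qed.

Lemma biannihilatorD N psi phi : biannihilator N psi -> biannihilator N phi ->
  biannihilator N (psi + phi).
Proof. by move=> h1 h2 f fN; rewrite dual_addE h1// h2// addr0. Qed.

Lemma biannihilatorZ N a psi : biannihilator N psi -> biannihilator N (a *: psi).
Proof. by move=> h f fN; rewrite dual_scaleE h// mulr0. Qed.

Lemma biannihilatorN N psi : biannihilator N psi -> biannihilator N (- psi).
Proof. by move=> h f fN; rewrite dual_oppE h// oppr0. Qed.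

Lemma biannihilator_canonical N x : N x -> biannihilator N (canonical_embedding x).
Proof. by move=> Nx f fN; exact: fN. Qed.

Lemma biannihilatorS N N' psi : N `<=` N' -> biannihilator N psi -> biannihilator N' psi.
Proof. by move=> NN' h f fN; apply: h => x /NN'; exact: fN. Qed.

Lemma biannihilator_lim (I : Type) (U : set_system I) (nu : I -> bidual X) psi N :
  ProperFilter U -> weak_star_cvg U nu psi ->
  (forall i, biannihilator N (nu i)) -> biannihilator N psi.
Proof.
move=> FU h hN.
apply: (@dual_eq0 _ _ _ psi [set f | forall x, N x -> f x = 0]) => [a f fN x Nx|f fN].
  by rewrite dual_scaleE fN// mulr0.
apply: (cvgr_to_le (h f)); apply: (@filterE I U) => i.
by rewrite (hN i f fN) scalar_Re0.
Qed.

(** By the Hahn-Banach theorem, [f] may be replaced by a functional with the same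
restriction to [N] and with norm at most [C]. *)
Lemma biannihilator_bound N psi f (C : R) : subspace_set N -> biannihilator N psi ->
  0 <= C -> (forall x, N x -> scalar_Re (f x) <= C * rnorm x) ->
  scalar_Re (psi f) <= C * rnorm psi.
Proof.
move=> sN Npsi C0 fC.
have [|g gC gf] := @hahn_banach_extension _ _ X N f C C0 sN _ fC.
  by move=> a x y _ _; rewrite dualD dualZ.
rewrite (biannihilator_eq Npsi (g := g)) => [|x Nx]; last by rewrite gf.
apply: le_trans (ler_Re_dual _ _) _.
by rewrite mulrC ler_wpM2r// rnorm_ge0.
Qed.

Lemma rnorm_canonical (x : X) : rnorm (canonical_embedding x) <= rnorm x.
Proof.
apply: rnorm_dual_le => f f1; apply: le_trans (ler_Re_dual f x) _.
by rewrite ler_piMl ?rnorm_ge0.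
Qed.

Lemma canonical_embeddingD (x y : X) :
  canonical_embedding (x + y) = canonical_embedding x + canonical_embedding y.
Proof. by apply/val_inj/funext => f; exact: dualD. Qed.

Lemma canonical_embeddingB (x y : X) :
  canonical_embedding (x - y) = canonical_embedding x - canonical_embedding y.
Proof. by apply/val_inj/funext => f; exact: dualB. Qed.

Lemma canonical_embeddingZ a (x : X) :
  canonical_embedding (a *: x) = a *: canonical_embedding x.
Proof. by apply/val_inj/funext => f; exact: dualZ. Qed.

Lemma dual_sumE m (F : 'I_m -> dual X) x : (\sum_i F i) x = \sum_i F i x.
Proof.
by apply: (big_morph (fun f : dual X => f x)) => // f g; exact: dual_addE.
Qed.

(** The real parts of the functionals of [H] map the ball of [N] onto a convex set,
to which [convex_set_approximation] applies. *)
Lemma goldstine N psi (r : R) (H : seq (dual X)) (e : R) : subspace_set N ->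
  biannihilator N psi -> 0 < r -> rnorm psi <= r -> 0 < e ->
  exists x, [/\ N x, rnorm x <= r &
    forall f, f \in H -> `|scalar_Re (f x) - scalar_Re (psi f)| < e].
Proof.
move=> sN Npsi r0 psir e0; pose m := size H.
pose F (i : 'I_m) := nth 0 H i.
pose ev x (i : 'I_m) := scalar_Re (F i x).
pose A := [set ev x | x in [set x | N x /\ rnorm x <= r]].
have Fr i x : rnorm x <= r -> scalar_Re (F i x) <= rnorm (F i) * r.
  by move=> xr; apply: le_trans (ler_Re_dual _ _) _; rewrite ler_wpM2l// rnorm_ge0.
pose v i := scalar_Re (psi (F i)).
have [|_ i [x [Nx xr] <-]|_ _ t [x [Nx xr] <-] [y [Ny yr] <-] /andP[t0 t1]|c S cS|_ [x [Nx xr] <-] xH] :=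
  @convex_set_approximation R m A v (\sum_i rnorm (F i) * r) _ _ _ _ e e0.
- by exists (ev 0), 0 => //; split; [exact: sN.1|rewrite rnorm0 ltW].
- have fi z : rnorm z <= r -> scalar_Re (F i z) <= \sum_i rnorm (F i) * r.
    move=> zr; apply: le_trans (Fr i z zr) _.
    rewrite (bigD1 i)//= lerDl; apply: sumr_ge0 => j _.
    by rewrite mulr_ge0 ?rnorm_ge0// ltW.
  by rewrite ler_norml fi// lerNl -scalar_ReN -dualN fi// rnormN.
- exists (scalar_of_real t *: (y - x) + x).
    split; first by apply: subspace_setD => //; apply: subspace_setZ => //;
      apply: subspace_setD => //; rewrite -scaleN1r; exact: subspace_setZ.
    have -> : scalar_of_real t *: (y - x) + x =
        scalar_of_real t *: y + scalar_of_real (1 - t) *: x.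
      rewrite scalerBr scalar_of_realD scalar_of_realN scalar_of_real1 scalerDl scale1r.
      by rewrite scaleNr -addrA [- _ + x]addrC.
    apply: le_trans (ler_rnormD _ _) _; rewrite !rnormZ_real.
    rewrite ger0_norm// ger0_norm ?subr_ge0//; nra.
  apply/funext => i; rewrite /ev dualD dualZ scalar_ReD [_ *: _]/(_ * _) scalar_ReZ.
  by rewrite dualB scalar_ReB addrC.
- (* a half-space containing the image of the ball of [N] is given by a
     functional which is small on [N] *)
  pose G := \sum_i scalar_of_real (c i) *: F i.
  have GE x : scalar_Re (G x) = \sum_i c i * ev x i.
    rewrite /G dual_sumE scalar_Re_sum; apply: eq_bigr => i _.
    by rewrite dual_scaleE scalar_ReZ.
  have psiG : scalar_Re (psi G) = \sum_i c i * v i.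
    rewrite /G (big_morph psi (dualD psi) (dual0 psi)) scalar_Re_sum.
    by apply: eq_bigr => i _; rewrite dualZ [_ *: _]/(_ * _) scalar_ReZ.
  have S0 : 0 <= S.
    have := cS (ev 0); rewrite -GE dual0 scalar_Re0; apply.
    by exists 0 => //; split; [exact: sN.1|rewrite rnorm0 ltW].
  rewrite -psiG; apply: le_trans (_ : S / r * rnorm psi <= _); last first.
    by rewrite mulrAC ler_pdivrMr// ler_wpM2l.
  apply: (biannihilator_bound sN Npsi); first by rewrite divr_ge0// ltW.
  move=> x Nx; have [->|x0] := eqVneq x 0.
    by rewrite dual0 scalar_Re0 rnorm0 mulr0.
  have nx : 0 < rnorm x.
    by rewrite lt_neqAle rnorm_ge0 andbT eq_sym; apply: contra x0 => /eqP/rnorm0_eq0->.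
  have := cS (ev (scalar_of_real (r / rnorm x) *: x)); rewrite -GE dualZ.
  rewrite [_ *: G x]/(_ * _) scalar_ReZ => le.
  rewrite mulrAC ler_pdivlMr//.
  have : r / rnorm x * scalar_Re (G x) <= S.
    apply: le; exists (scalar_of_real (r / rnorm x) *: x); last by [].
    split; first exact: subspace_setZ.
    by rewrite rnormZ_real gtr0_norm ?divr_gt0// divfK ?gt_eqF.
  by rewrite mulrAC ler_pdivrMr// mulrC.
- exists x; split=> // f fH; have iH : (index f H < m)%N by rewrite index_mem.
  by have := xH (Ordinal iH); rewrite /ev /v /F/= nth_index.
Qed.

End Biannihilator.

(** * Weak neighbourhoods of zero in the unit ball *)

Section WeakTopology.
Context (R : realType) (k : scalar_kind).
Local Notation K := (scalars R k).
Context (V : normedModType K).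
Implicit Types (f : dual V) (L : seq (dual V * R)) (H : seq (dual V)).

(** These sets form a base of the relative weak topology of the unit ball. *)
Definition slab L : set V :=
  [set x | rnorm x <= 1 /\ forall u, u \in L -> u.2 < scalar_Re (u.1 x)].

Lemma rnorm_le1 (x : V) : (rnorm x <= 1) = (`|x| <= 1).
Proof. by rewrite -(scalar_of_real_le k) rnormE scalar_of_real1. Qed.

Lemma open_half_plane (c : R) : open [set z : K^o | c < scalar_Re z].
Proof.
rewrite openE => z /= cz; apply/nbhs_ballP.
exists (scalar_of_real (scalar_Re z - c)) => /=.
  rewrite lt_neqAle scalar_of_real_ge0 subr_ge0 (ltW cz) andbT eq_sym.
  rewrite -(scalar_of_real0 R k) (inj_eq (@scalar_of_real_inj R k)).
  by rewrite subr_eq0 gt_eqF.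
move=> w; rewrite -ball_normE /= => zw.
have : scalar_Re (z - w) < scalar_Re z - c.
  apply: le_lt_trans (ler_Re_rnorm _) _; rewrite /rnorm.
  rewrite lt_neqAle -(scalar_of_real_le k) ge0_scalar_ReK// (ltW zw) andbT.
  apply/eqP => e; move: zw; rewrite -e ge0_scalar_ReK// ltxx; by [].
rewrite scalar_ReB; lra.
Qed.

Lemma nbhs_weak_half_space f c x : c < scalar_Re (f x) ->
  nbhs (x : weak V) [set y : weak V | c < scalar_Re (f y)].
Proof.
move=> cx; have /cvg_sup/(_ f) : nbhs (x : weak V) --> (x : weak V) by [].
apply; apply: open_nbhs_nbhs; split=> //.
by exists [set z : K^o | c < scalar_Re z] => //; exact: open_half_plane.
Qed.

Lemma slab_relatively_weakly_open L : relatively_weakly_open (slab L).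
Proof.
exists [set x : weak V | forall u, u \in L -> u.2 < scalar_Re (u.1 x)]; last first.
  apply/seteqP; split=> x /=; rewrite /slab/= rnorm_le1.
    by move=> [? ?]; split.
  by move=> [? ?]; split.
rewrite openE => x; rewrite /= => xL; rewrite /interior.
elim: L xL => [|u L IH] xL; first exact: filterE.
have /IH IL : forall v, v \in L -> v.2 < scalar_Re (v.1 x).
  by move=> v vL; apply: xL; rewrite inE vL orbT.
have := @nbhs_weak_half_space u.1 u.2 x (xL u (mem_head _ _)).
apply: filterS2 IL => y yL yu v; rewrite inE => /orP[/eqP->//|]; exact: yL.
Qed.

Lemma weakly_open_basic (W : set (weak V)) : open W -> W 0 ->
  exists H, exists2 e : R, 0 < e &
    forall x, (forall h, h \in H -> rnorm (h x) < e) -> W x.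
Proof.
rewrite openE => oW W0.
pose B (j : seq (dual V) * R) : set V :=
  [set x | forall h, h \in j.1 -> rnorm (h x) < j.2].
pose F := filter_from [set j : seq (dual V) * R | 0 < j.2] B.
have FF : Filter F.
  apply: filter_from_filter; first by exists ([::], 1) => /=.
  move=> i j /= i0 j0; exists (i.1 ++ j.1, Num.min i.2 j.2).
    by rewrite /= lt_min i0.
  move=> x /= xB; split=> h hH.
    have := xB h; rewrite mem_cat hH => /(_ isT); rewrite lt_min; by case/andP.
  have := xB h; rewrite mem_cat hH orbT => /(_ isT); rewrite lt_min; by case/andP.
suff : F --> (0 : weak V).
  by move=> /(_ _ (oW 0 W0)) [[H e] /= e0 HW]; exists H, e.
apply/cvg_sup => f A; rewrite nbhsE => -[_ [[G oG <-] /= G0] GA].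
have := open_nbhs_nbhs (conj oG G0); rewrite dual0 => /nbhs_ballP[e /= e0 eG].
exists ([:: f], scalar_Re e) => /=.
  rewrite lt_neqAle ge0_scalar_Re_ge0 ?(ltW e0)// andbT.
  apply/eqP => h; move: (e0).
  by rewrite -(ge0_scalar_ReK (ltW e0)) -h scalar_of_real0 ltxx.
move=> x /(_ f (mem_head _ _)) fx; apply/GA/eG.
rewrite -ball_normE /= sub0r normrN.
rewrite lt_neqAle -(ge0_scalar_Re_le (normr_ge0 _) (ltW e0)) (ltW fx) andbT.
by apply/eqP => h; move: fx; rewrite /rnorm h ltxx.
Qed.

(** Since [0] is the midpoint of [p] and [- p], the combination [1/2 (C - C)] is a
weak neighbourhood of [0] in the ball, for each slab [C] containing [p]. *)
Lemma CWO_B_midpoint L p : CWO_B V -> slab L p ->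
  exists H, exists2 e : R, 0 < e &
    forall w, rnorm w <= 1 -> (forall h, h \in H -> rnorm (h w) < e) ->
    exists u v, [/\ slab L u, slab L v & w = 2^-1 *: (u - v)].
Proof.
move=> cwo Lp; pose L' := [seq (- u.1, u.2) | u <- L].
have L'E x : slab L' x -> slab L (- x).
  move=> [x1 xL]; split; first by rewrite rnormN.
  by move=> u uL; rewrite dualN; exact: (xL _ (map_f _ uL)).
have L'p : slab L' (- p).
  split; first by rewrite rnormN; exact: Lp.1.
  move=> _ /mapP[u uL ->]; change (u.2 < scalar_Re (- u.1 (- p))).
  by rewrite dualN opprK; exact: Lp.2.
pose U (i : 'I_2) := if i == ord0 then slab L else slab L'.
have h2 : (0 : K) < 2^-1 by rewrite invr_gt0.
have [//||j||W [W' oW' WE] [W0 WU]] := cwo 2%N (fun=> 2^-1) U _ _ _ 0.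
- by rewrite !big_ord_recl big_ord0 addr0 -[2^-1]mul1r -splitr.
- by rewrite /U; case: ifP => _; exact: slab_relatively_weakly_open.
- split; last by rewrite /open_unit_ball/= normr0.
  exists (fun i : 'I_2 => if i == ord0 then p else - p).
    by move=> j; rewrite /U; case: ifP.
  by rewrite !big_ord_recl big_ord0 addr0 /= scalerN subrr.
have [|H [e e0 HW]] := weakly_open_basic oW'; first by move: W0; rewrite WE => -[].
exists H, e => // w w1 wH.
have [|u uU ->] := WU w.
  by rewrite WE; split; [exact: HW|rewrite /closed_unit_ball/= -rnorm_le1].
exists (u ord0), (- u (lift ord0 ord0)); split.
- by have := uU ord0.
- by apply: L'E; have := uU (lift ord0 ord0).
- by rewrite !big_ord_recl big_ord0 addr0 opprK scalerDr.
Qed.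

End WeakTopology.

(** * Infinite-dimensional spaces with property CWO-B are not reflexive *)

Section LinearSpan.
Context (K : numFieldType) (V : lmodType K).
Implicit Types (es : seq V) (x y : V).

(** The span is defined by recursion because the points are produced one at a
time. *)
Fixpoint lspan es : set V :=
  if es is e :: es' then [set x | exists a, exists2 y, lspan es' y & x = a *: e + y]
  else [set 0].

Lemma lspan_sum es x : lspan es x ->
  exists c : 'I_(size es) -> K, x = \sum_(i < size es) c i *: nth 0 es i.
Proof.
elim: es x => [x /= ->|e es IH x [a [_ /IH[c ->] ->]]].
  by exists (fun=> 0); rewrite big_ord0.
exists (fun i : 'I_(size es).+1 => if unlift ord0 i is Some j then c j else a).
rewrite /= big_ord_recl unlift_none; congr (_ + _).
by apply: eq_bigr => i _; rewrite liftK.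
Qed.

Lemma lspan0 es : lspan es 0.
Proof. by elim: es => //= e es IH; exists 0, 0; rewrite // scale0r add0r. Qed.

Lemma lspanP es a x y : lspan es x -> lspan es y -> lspan es (a *: x + y).
Proof.
elim: es x y => [x y /= -> ->|e es IH x y [b [u Nu ->]] [c [v Nv ->]]] /=.
  by rewrite scaler0 addr0.
exists (a * b + c), (a *: u + v); first exact: IH.
by rewrite scalerDr scalerA addrACA -scalerDl.
Qed.

Lemma lspan_cons e es : lspan es `<=` lspan (e :: es).
Proof. by move=> x xs /=; exists 0, x; rewrite // scale0r add0r. Qed.

Lemma lspan_head e es : lspan (e :: es) e.
Proof. by exists 1, 0; [exact: lspan0|rewrite scale1r addr0]. Qed.

End LinearSpan.

Section InfiniteDimension.
Context (R : realType) (k : scalar_kind).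
Local Notation K := (scalars R k).
Context (V : normedModType K).

(** Each functional cuts the dimension down by at most one. *)
Lemma infinite_dimensional_kernel (H : seq (dual V)) : infinite_dimensional V ->
  exists2 w : V, rnorm w = 1 & forall h, h \in H -> h w = 0.
Proof.
move=> iV; suff [w w0 wH] : exists2 w : V, w != 0 & forall h, h \in H -> h w = 0.
  exists (scalar_of_real (rnorm w)^-1 *: w); first exact: rnorm1_normalize.
  by move=> h hH; rewrite dualZ wH// scaler0.
suff nospan es : ~ [set x | forall h, h \in H -> h x = 0] `<=` lspan es.
  apply: contrapT => now; apply: (nospan [::]) => x /= xH.
  by apply: contrapT => x0; apply: now; exists x => //; apply/eqP.
elim: H es => [|h H IH] es sub.
  apply: iV; exists (size es), (nth 0 es) => x.
  by apply: lspan_sum; apply: sub.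
have [[v [vH hv]]|nov] :=
    pselect (exists v, (forall g, g \in H -> g v = 0) /\ h v != 0).
  apply: (IH (v :: es)) => x /= xH.
  exists (h x / h v), (x - (h x / h v) *: v); last by rewrite addrC subrK.
  apply: sub => g; rewrite inE dualB dualZ => /orP[/eqP->|gH].
    by rewrite -[_ *: _]/(h x / h v * h v : K) divfK// subrr.
  by rewrite (xH g gH) (vH g gH) scaler0 subrr.
apply: (IH es) => x xH; apply: sub => g; rewrite inE => /orP[/eqP->|]; last exact: xH.
by apply: contrapT => hx; apply: nov; exists x; split=> //; apply/eqP.
Qed.

End InfiniteDimension.

Lemma scalars_separable (R : realType) (k : scalar_kind) :
  exists q : nat -> scalars R k, q 0%N = 0 /\
    forall a e, 0 < e -> exists n, rnorm (a - q n : (scalars R k)^o) < e.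
Proof.
suff [T [q qd]] : exists (T : countType) (q : T -> scalars R k),
    forall a e, 0 < e -> exists t, rnorm (a - q t : (scalars R k)^o) < e.
  exists (fun n => if n is m.+1 then if unpickle m is Some t then q t else 0 else 0).
  by split=> // a e e0; have [t te] := qd a e e0; exists (pickle t).+1; rewrite pickleK.
have ratd (a e : R) : 0 < e -> exists t : rat, `|a - ratr t| < e.
  move=> e0; have [t] := @rat_in_itvoo R (a - e) (a + e) ltac:(lra).
  by rewrite in_itv/= => /andP[h1 h2]; exists t; rewrite ltr_norml; apply/andP; split; lra.
case: k => [|].
  by exists rat, ratr => a e /(ratd a).
exists (rat * rat)%type, (fun t => (ratr t.1 +i* ratr t.2)%C) => -[a b] e e0.
have e20 : 0 < e / 2 by rewrite divr_gt0.
have [s sa] := ratd a _ e20; have [t tb] := ratd b _ e20; exists (s, t).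
apply: le_lt_trans (complex_norm_le (a - ratr s) (b - ratr t)) _; lra.
Qed.

Section NonReflexivity.
Context (R : realType) (k : scalar_kind).
Local Notation K := (scalars R k).
Context (V : normedModType K).
Hypotheses (iV : infinite_dimensional V) (cwo : CWO_B V).
Implicit Types (L : seq (dual V * R)) (us : seq V).

(** A nonempty slab contains a nonempty smaller slab at distance at least [1/2]
from any given point: [1/2 (C - C)] contains unit vectors, so [C] has diameter [2]. *)
Lemma slab_avoid L p y : slab L p ->
  exists f : dual V, exists2 p', rnorm f <= 1 & slab ((f, scalar_Re (f y) + 2^-1) :: L) p'.
Proof.
move=> Lp; have [H [e e0 HL]] := CWO_B_midpoint cwo Lp.
have [w w1 wH] := infinite_dimensional_kernel H iV.
have [||u [v [Lu Lv wE]]] := HL w.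
- by rewrite w1.
- by move=> h hH; rewrite wH// rnorm0.
have [z Lz zy] : exists2 z, slab L z & 1 <= rnorm (z - y).
  have : 2 <= rnorm (u - y) + rnorm (v - y).
    have -> : 2 = rnorm (u - v).
      have -> : u - v = scalar_of_real 2 *: w.
        rewrite wE scalerA scalar_of_realD scalar_of_real1.
        by rewrite mulfV ?scale1r// pnatr_eq0.
      by rewrite rnormZ_real w1 mulr1 ger0_norm.
    have -> : u - v = (u - y) - (v - y) by rewrite opprB addrA subrK.
    exact: ler_rnormB.
  have [uy _|uy h] := leP 1 (rnorm (u - y)); first by exists u.
  by exists v => //; lra.
have [f f1 fz] := norming_functional (z - y).
exists f, z => //; split; first exact: Lz.1.
move=> g; rewrite inE => /orP[/eqP->/=|]; last exact: Lz.2.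
by move: fz; rewrite dualB scalar_ReB; lra.
Qed.

Lemma slab_avoid_seq (ys : seq V) L p : slab L p ->
  exists L' p', slab (L' ++ L) p' /\ forall y, y \in ys ->
    exists2 f : dual V, rnorm f <= 1 & (f, scalar_Re (f y) + 2^-1) \in L'.
Proof.
elim: ys L p => [L p Lp|y ys IH L p Lp]; first by exists [::], p.
have [f [p' f1 /IH[L' [p'' [Lp'' L'P]]]]] := slab_avoid y Lp.
exists (rcons L' (f, scalar_Re (f y) + 2^-1)), p''; rewrite cat_rcons.
split=> // z; rewrite inE => /orP[/eqP->|/L'P[g g1 gL']].
  by exists f => //; rewrite mem_rcons mem_head.
by exists g => //; rewrite mem_rcons inE gL' orbT.
Qed.

Section Grid.
Variable q : nat -> K.

(** The finite part of a countable dense subset of the span that is to be avoided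
at stage [n]. *)
Fixpoint grid n us : seq V :=
  if us is e :: us' then [seq q i *: e + y | i <- iota 0 n.+1, y <- grid n us']
  else [:: 0].

Lemma mem_grid n e us x : reflect
  (exists i, exists2 y, (i <= n)%N && (y \in grid n us) & x = q i *: e + y)
  (x \in grid n (e :: us)).
Proof.
have iE i : (i \in iota 0 n.+1) = (i <= n)%N by rewrite mem_iota add0n ltnS.
apply: (iffP allpairsP) => [[[i y] [im yg ->]]|[i [y /andP[im yg] ->]]].
  by exists i, y; rewrite // -iE; apply/andP.
by exists (i, y); split; rewrite // iE.
Qed.

Lemma grid_le m n us : (m <= n)%N -> {subset grid m us <= grid n us}.
Proof.
move=> mn; elim: us => [//|e us IH] x /mem_grid[i [y /andP[im yg] ->]].
by apply/mem_grid; exists i, y; rewrite // (leq_trans im mn) IH.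
Qed.

Hypotheses (q0 : q 0%N = 0)
  (qd : forall a e, 0 < e -> exists n, rnorm (a - q n : K^o) < e).

Lemma grid_cons n e us : {subset grid n us <= grid n (e :: us)}.
Proof.
move=> y yg; apply/mem_grid; exists 0%N, y; first by rewrite yg.
by rewrite q0 scale0r add0r.
Qed.

Lemma grid_dense us x e : lspan us x -> 0 < e ->
  exists n, exists2 y, y \in grid n us & rnorm (x - y) < e.
Proof.
elim: us x e => [x e /= -> e0|d us IH x e /= [a [y /IH yus ->]] e0].
  by exists 0%N, 0; rewrite ?mem_head// subrr rnorm0.
have e20 : 0 < e / 2 by rewrite divr_gt0.
have [n [z zg yz]] := yus _ e20.
have d0 : 0 < rnorm d + 1 by rewrite ltr_wpDl// rnorm_ge0.
have [i iP] := qd a (divr_gt0 e20 d0).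
exists (maxn i n), (q i *: d + z).
  apply/mem_grid; exists i, z => //.
  by rewrite leq_maxl (grid_le (leq_maxr i n) zg).
rewrite opprD addrACA -scalerBl; apply: le_lt_trans (ler_rnormD _ _) _.
rewrite rnormZ -[scalar_Re _]/(rnorm (a - q i : K^o)).
have : rnorm (a - q i : K^o) * rnorm d <= e / 2.
  rewrite ltr_pdivlMr// in iP; apply: le_trans (ltW iP).
  by rewrite ler_wpM2l ?rnorm_ge0// lerDl.
by move=> *; lra.
Qed.

End Grid.

(** Points [p_n] are picked in decreasing slabs, each staying away from a
finer and finer grid of combinations of the points picked so far. A weak-star
cluster point of [p_n] belonging to the space would lie in their closed linear
span, yet at distance at least [1/2] from a dense subset of it. *)
Lemma CWO_B_nonreflexive : exists2 psi : bidual V, rnorm psi <= 1 &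
  forall x, psi <> canonical_embedding x.
Proof.
have [q [q0 qd]] := scalars_separable R k.
pose T := {s : seq (dual V * R) * seq V | slab s.1 !=set0}.
pose step (s s' : T) := exists p, exists L', [/\ slab (sval s).1 p,
  (sval s').2 = p :: (sval s).2, (sval s').1 = L' ++ (sval s).1 &
  forall y, y \in grid q (size (sval s).2) (sval s).2 ->
    exists2 f : dual V, rnorm f <= 1 & (f, scalar_Re (f y) + 2^-1) \in L'].
have T0 : slab (V := V) [::] !=set0 by exists 0; split=> //; rewrite rnorm0.
have stepP s : {s' | step s s'}.
  apply: cid; case: s => -[L us] [p Lp].
  have [L' [p' [Lp' L'P]]] := slab_avoid_seq (grid q (size us) us) Lp.
  have ne : slab (L' ++ L, p :: us).1 !=set0 by exists p'.
  by exists (exist _ (L' ++ L, p :: us) ne), p, L'.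
have [s [s0 sS]] := dependent_choice stepP (exist _ ([::], [::]) T0).
pose L n := (sval (s n)).1; pose us n := (sval (s n)).2.
pose Q n p := exists L', [/\ slab (L n) p, us n.+1 = p :: us n, L n.+1 = L' ++ L n &
  forall y, y \in grid q (size (us n)) (us n) ->
    exists2 f : dual V, rnorm f <= 1 & (f, scalar_Re (f y) + 2^-1) \in L'].
have [p pP] : {p : nat -> V & forall n, Q n (p n)} by apply: (@choice _ _ Q) => n; exact: sS.
have sus n : size (us n) = n.
  elim: n => [|n IH]; first by rewrite /us s0.
  by have [L' [_ -> _ _]] := pP n; rewrite /= IH.
have Lle m n : (m <= n)%N -> {subset L m <= L n}.
  elim: n => [|n IH]; first by rewrite leqn0 => /eqP->.
  rewrite leq_eqVlt => /orP[/eqP->//|/IH sL u /sL uL].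
  by have [L' [_ _ -> _]] := pP n; rewrite mem_cat uL orbT.
have spanle m n : (m <= n)%N -> lspan (us m) `<=` lspan (us n).
  elim: n => [|n IH]; first by rewrite leqn0 => /eqP->.
  rewrite leq_eqVlt => /orP[/eqP->//|/IH sL u /sL uL].
  by have [L' [_ -> _ _]] := pP n; exact: lspan_cons.
have gridle j m n : (m <= n)%N -> {subset grid q j (us m) <= grid q j (us n)}.
  elim: n => [|n IH]; first by rewrite leqn0 => /eqP->.
  rewrite leq_eqVlt => /orP[/eqP->//|/IH sL u /sL uL].
  by have [L' [_ -> _ _]] := pP n; exact: grid_cons.
have pL m n u : (m <= n)%N -> u \in L m -> u.2 < scalar_Re (u.1 (p n)).
  by move=> mn /(Lle m n mn); have [L' [[_ +] _ _ _]] := pP n; apply.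
have [U [UU ooU]] := @ultraFilterLemma nat \oo _.
have FU : ProperFilter U by exact: ultra_proper.
have p1 n : rnorm (canonical_embedding (p n)) <= 1.
  by have [L' [[h _] _ _ _]] := pP n; exact: le_trans (rnorm_canonical _) h.
have [psi psi1 psil] := ultrafilter_weak_star_cvg UU ler01 p1.
exists psi => // x psix.
pose N := [set y | exists n, lspan (us n) y].
have sN : subspace_set N.
  split=> [|a y z [m my] [n nz]]; first by exists 0%N; exact: lspan0.
  exists (maxn m n); apply: lspanP.
    exact: spanle (leq_maxl m n) _ my.
  exact: spanle (leq_maxr m n) _ nz.
have [y [m my] xy] : exists2 y, N y & rnorm (x - y) < 4^-1.
  apply: contrapT => noy; have [|y Ny|f [f1 fN fx]] := @hahn_banach_separation R k V N x 4^-1 sN.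
  - by rewrite invr_ge0.
  - by rewrite leNgt; apply/negP => h; apply: noy; exists y.
  have : scalar_Re (psi f) <= 0.
    apply: (cvgr_to_le (psil f)); apply: (@filterE _ U) => n.
    change (scalar_Re (f (p n)) <= 0); rewrite fN ?scalar_Re0//.
    by exists n.+1; have [L' [_ -> _ _]] := pP n; exact: lspan_head.
  rewrite psix => h; have : 4^-1 <= (0 : R) by apply: le_trans fx h.
  by rewrite leNgt invr_gt0 ltr0n.
have [j [z zg yz]] := grid_dense qd my (e := 4^-1) ltac:(by rewrite invr_gt0).
pose n := maxn j m.
have zn : z \in grid q (size (us n)) (us n).
  by rewrite sus; apply: gridle (leq_maxr j m) _ _; apply: grid_le (leq_maxl j m) _ _.
have [L' [_ _ LE /(_ z zn)[f f1 fL']]] := pP n.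
have fL : (f, scalar_Re (f z) + 2^-1) \in L n.+1 by rewrite LE mem_cat fL'.
have : scalar_Re (f z) + 2^-1 <= scalar_Re (psi f).
  apply: (weak_star_cvg_ge FU psil); apply: ooU; exists n.+1 => // i /= ni.
  by apply/ltW; exact: (pL _ _ _ ni fL).
rewrite psix; change (canonical_embedding x f) with (f x) => h.
have : scalar_Re (f (x - z)) <= rnorm (x - z).
  by apply: le_trans (ler_Re_dual _ _) _; rewrite ler_piMl ?rnorm_ge0.
rewrite dualB scalar_ReB.
have : rnorm (x - z) <= rnorm (x - y) + rnorm (y - z).
  by rewrite -[x - z](subrKA y) ler_rnormD.
move=> h1 h2; suff : (2^-1 : R) < 2^-1 by rewrite ltxx.
by move: h h1 h2 xy yz => *; lra.
Qed.

End NonReflexivity.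

(** * Functionals whose sum and difference are both short *)

Section UnitPairs.
Context (R : realType) (k : scalar_kind).
Implicit Type U : normedModType (scalars R k).

(** A pair of unit vectors [f], [g] can fail to have a sum and a difference of norm
smaller than [2] only if one of [f + g], [f - g] has norm [2]; in the first case
[3 f + g] and [f - g] do better, since their sum and difference are [4 f] and
[2 (f + g)], of norm [4], while [3 f + g] already has norm [4]. *)
Lemma rnorm_pair_of_l1 U (f g : U) : rnorm f = 1 -> rnorm g = 1 ->
  f != g -> 2 <= rnorm (f + g) ->
  exists a b : U, exists C : R,
    [/\ rnorm (a + b) <= C, rnorm (a - b) <= C & C < rnorm a + rnorm b].
Proof.
move=> f1 g1 fg fg2; pose t := @scalar_of_real R k.
have nZ (r : R) (h : U) : 0 <= r -> rnorm (t r *: h) = r * rnorm h.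
  by move=> r0; rewrite rnormZ_real ger0_norm.
have t3 : t 3 = t 2 + 1 by rewrite /t -scalar_of_real1 -scalar_of_realD; congr scalar_of_real; lra.
have t4 : t 4 = t 3 + 1 by rewrite /t -scalar_of_real1 -scalar_of_realD; congr scalar_of_real; lra.
have t2 : t 2 = 1 + 1 by rewrite /t -scalar_of_real1 -scalar_of_realD; congr scalar_of_real; lra.
exists (t 3 *: f + g), (f - g), 4; split.
- have -> : t 3 *: f + g + (f - g) = t 4 *: f.
    by rewrite addrACA subrr addr0 t4 scalerDl scale1r.
  by rewrite nZ// f1 mulr1.
- have -> : t 3 *: f + g - (f - g) = t 2 *: (f + g).
    rewrite opprB [g - f]addrC t3 scalerDl scale1r addrACA addrK scalerDr.
    by congr (_ + _); rewrite t2 scalerDl scale1r.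
  rewrite nZ//; have := ler_rnormD f g; rewrite f1 g1 => *; lra.
- have h : t 3 *: (f + g) = (t 3 *: f + g) + t 2 *: g.
    rewrite scalerDr -addrA; congr (_ + _).
    by rewrite t3 scalerDl scale1r addrC.
  have := ler_rnormD (t 3 *: f + g) (t 2 *: g); rewrite -h !nZ// g1.
  have : 0 < rnorm (f - g).
    rewrite lt_neqAle rnorm_ge0 andbT eq_sym; apply: contra fg => /eqP/rnorm0_eq0/eqP.
    by rewrite subr_eq0.
  by move=> *; lra.
Qed.

End UnitPairs.

Section DualPair.
Context (R : realType) (k : scalar_kind).
Local Notation K := (scalars R k).
Context (V : normedModType K).
Implicit Types f g : dual V.

Lemma dual_approx_norm f (d : R) : 0 < d ->
  exists2 x, rnorm x <= 1 & rnorm f - d < scalar_Re (f x).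
Proof.
move=> d0; apply: contrapT => nox.
suff : rnorm f <= rnorm f - d by rewrite lerBrDr gerDl leNgt d0.
apply: rnorm_dual_le => x x1; rewrite leNgt; apply/negP => h.
by apply: nox; exists x.
Qed.

Lemma dual_normalize (w : V) f : f w != 0 -> exists2 a : K, a != 0 & rnorm (a *: f) = 1.
Proof.
move=> fw; have f0 : f != 0 by apply: contra fw => /eqP ->.
exists (scalar_of_real (rnorm f)^-1); last exact: rnorm1_normalize.
rewrite -(scalar_of_real0 R k) (inj_eq (@scalar_of_real_inj R k)) invr_eq0.
by apply: contra f0 => /eqP/rnorm0_eq0->.
Qed.

(** Two independent unit functionals [f], [g] will do if both [f + g] and [f - g]
have norm less than [2]; otherwise [rnorm_pair_of_l1] applies to [f] and one of [g],
[- g]. *)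
Lemma dual_pair : infinite_dimensional V ->
  exists a b : dual V, exists C : R,
    [/\ rnorm (a + b) <= C, rnorm (a - b) <= C & C < rnorm a + rnorm b].
Proof.
move=> iV.
have [w1 nw1 _] := infinite_dimensional_kernel [::] iV.
have [f0 _ f0w] := norming_functional w1.
have f0w1 : f0 w1 != 0.
  by apply/eqP => h; move: f0w; rewrite h nw1 scalar_Re0 ler10.
have [w2 nw2 w2H] := infinite_dimensional_kernel [:: f0] iV.
have [g0 _ g0w] := norming_functional w2.
have g0w2 : g0 w2 != 0.
  by apply/eqP => h; move: g0w; rewrite h nw2 scalar_Re0 ler10.
have [a a0 f1] := dual_normalize f0w1; have [b b0 g1] := dual_normalize g0w2.
set f := a *: f0 in f1; set g := b *: g0 in g1.
have fw2 : f w2 = 0 by rewrite dual_scaleE w2H ?mem_head// mulr0.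
have gw2 : g w2 != 0 by rewrite dual_scaleE mulf_neq0.
have fg : f != g by apply: contra gw2 => /eqP <-; rewrite fw2.
have fNg : f != - g.
  by apply: contra gw2 => /eqP h; rewrite -oppr_eq0 -dual_oppE -h fw2.
have [h2|h2] := leP 2 (rnorm (f + g)); first exact: rnorm_pair_of_l1 h2.
have [h3|h3] := leP 2 (rnorm (f - g)).
  by apply: rnorm_pair_of_l1 h3; rewrite ?rnormN.
exists f, g, (Num.max (rnorm (f + g)) (rnorm (f - g))).
by rewrite !le_max !lexx orbT f1 g1 gt_max h2 h3.
Qed.

End DualPair.


(** * The bidual of a closed subspace *)

Section Subspace.
Context (R : realType) (k : scalar_kind).
Local Notation K := (scalars R k).
Context (X : normedModType K) (M : submodClosed X).
Local Notation W := (linear_subspace M).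
Local Notation N := ([set x : X | x \in M]).

Lemma subspace_set_submod : subspace_set N.
Proof.
split; first exact: rpred0.
by move=> a x y xM yM; apply: rpredD => //; exact: rpredZ.
Qed.

Lemma linear_subspace_valP (a : K) (x y : W) : val (a *: x + y) = a *: val x + val y.
Proof. by []. Qed.

Lemma dual_restrict_proof (f : dual X) : (fun x : W => f (val x)) \in @is_dual R k W.
Proof.
apply: (@bounded_linear_dual R k W (fun x : W => f (val x)) (dual_norm f)) => [a x y|x].
  by rewrite linear_subspace_valP dualD dualZ.
exact: dual_normP.
Qed.

Definition dual_restrict (f : dual X) : dual W := Dual (dual_restrict_proof f).

Lemma dual_extend (g : dual W) : exists f : dual X, forall x : W, f (val x) = g x.
Proof.
pose f0 (x : X) : K := if insub x is Some y then g y else 0.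
have f0E (x : W) : f0 (val x) = g x by rewrite /f0 valK.
have [|x xN|f _ fE] := @hahn_banach_extension R k X N f0 (rnorm g) (rnorm_ge0 g) subspace_set_submod.
- move=> a x y xN yN.
  rewrite -[x](SubK W xN) -[y](SubK W yN).
  by rewrite -linear_subspace_valP !f0E dualD dualZ.
- by rewrite -[x](SubK W xN) f0E; exact: ler_Re_dual.
by exists f => x; rewrite -f0E; apply: fE; exact: (valP x).
Qed.

Lemma closed_subspace_dist (x : X) : closed N -> x \notin M ->
  exists2 d : R, 0 < d & forall n, N n -> d <= rnorm (x - n).
Proof.
move=> cN xN; have oN : open (~` N) by exact: closed_openC.
have : nbhs x (~` N) by apply: open_nbhs_nbhs; split=> //; apply/negP.
move=> /nbhs_ballP[e /= e0 eN].
exists (scalar_Re e) => [|n nN].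
  rewrite lt_neqAle ge0_scalar_Re_ge0 ?(ltW e0)// andbT.
  apply/eqP => h; move: (e0).
  by rewrite -(ge0_scalar_ReK (ltW e0)) -h scalar_of_real0 ltxx.
rewrite leNgt; apply/negP => h; apply: (eN n) nN.
rewrite -ball_normE /= lt_neqAle -(ge0_scalar_Re_le (normr_ge0 _) (ltW e0)) (ltW h) andbT.
by apply/eqP => h'; move: h; rewrite /rnorm h' ltxx.
Qed.

Lemma biannihilator_canonical_closed (x : X) : closed N ->
  biannihilator N (canonical_embedding x) -> x \in M.
Proof.
move=> cN Nx; apply: contrapT => /negP xN.
have [d d0 dN] := closed_subspace_dist cN xN.
have [f [_ fN fx]] := hahn_banach_separation subspace_set_submod (ltW d0) dN.
have : f x = 0 := Nx f fN.
by move=> h; move: fx; rewrite h scalar_Re0 leNgt d0.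
Qed.

(** Composition with the restriction to [M] embeds the bidual of [M] in that of
[X]. *)
Lemma biannihilator_nonreflexive : closed N -> infinite_dimensional W ->
  CWO_B W -> exists2 psi : bidual X, biannihilator N psi &
    forall x, psi <> canonical_embedding x.
Proof.
move=> cN iW cwo; have [phi phi1 phix] := CWO_B_nonreflexive iW cwo.
have lin : linear (fun f : dual X => phi (dual_restrict f) : K^o).
  move=> a f g; rewrite -dualZ -dualD; congr (phi _).
  exact/val_inj/funext.
have bnd f : rnorm (phi (dual_restrict f) : K^o) <= rnorm phi * rnorm f.
  rewrite rnorm_dual; apply: le_trans (dual_normP _ _) _.
  rewrite -!rnorm_dual ler_wpM2l ?rnorm_ge0//.
  by apply: rnorm_dual_le => x x1; apply: le_trans (ler_Re_dual f (val x)) _; rewrite ler_piMr ?rnorm_ge0.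
pose psi : bidual X := Dual (bounded_linear_dual lin bnd).
have psiE (f : dual X) (g : dual W) : (forall x : W, f (val x) = g x) -> psi f = phi g.
  by move=> fg; congr (phi _); apply/val_inj/funext.
have psiN : biannihilator N psi.
  move=> f fN; rewrite (psiE f 0) ?dual0// => x.
  by apply: fN; exact: (valP x).
exists psi => // x psix.
have xM : x \in M by apply: biannihilator_canonical_closed => //; rewrite -psix.
apply: (phix (Sub x xM)); apply/val_inj/funext => g.
have [f fE] := dual_extend g.
apply: etrans (esym (psiE f g fE)) _; rewrite psix.
by have := fE (Sub x xM); rewrite SubK.
Qed.

End Subspace.

(** * Midpoints in the bidual of a subspace *)

Section MidpointsInBidual.
Context (R : realType) (k : scalar_kind).
Local Notation K := (scalars R k).
Context (X : normedModType K) (M : submodClosed X).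
Local Notation W := (linear_subspace M).
Local Notation N := ([set x : X | x \in M]).

Lemma rnorm_val (x : W) : rnorm (val x) = rnorm x.
Proof. by []. Qed.

Lemma dual_Re_test_seq (H : seq (dual W)) (e : R) : 0 < e ->
  exists G : seq (dual X), forall x : W,
    (forall f, f \in G -> `|scalar_Re (f (val x))| < e / 2) ->
    forall h, h \in H -> rnorm (h x) < e.
Proof.
move=> e0; have [j jP] := scalar_rnorm_le R k.
elim: H => [|h H [G GP]]; first by exists [::].
have [f fE] := dual_extend h.
exists [:: f, j *: f & G] => x xG g; rewrite inE => /orP[/eqP->|]; last first.
  by apply: GP => l lG; apply: xG; rewrite !inE lG !orbT.
apply: le_lt_trans (jP _) _; rewrite -fE [e]splitr; apply: ltrD.
  by apply: xG; rewrite mem_head.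
by have := xG (j *: f); rewrite !inE eqxx orbT; exact.
Qed.

Lemma dual_Re_half (V : normedModType K) (f : dual V) (x : V) :
  scalar_Re (f (2^-1 *: x)) = 2^-1 * scalar_Re (f x).
Proof.
suff -> : 2^-1 = scalar_of_real 2^-1 :> K by rewrite dualZ scalar_ReZ.
by case: k => //=; rewrite fmorphV rmorph_nat.
Qed.

Lemma midpoint_add (V : normedModType K) (u v : V) :
  2^-1 *: (u + v) + 2^-1 *: (u - v) = u /\ 2^-1 *: (u + v) - 2^-1 *: (u - v) = v.
Proof.
have half (x : V) : 2^-1 *: (x + x) = x.
  by rewrite scalerDr -scalerDl -[2^-1]mul1r -splitr scale1r.
rewrite -scalerBr -scalerDr; split.
  by rewrite addrACA subrr addr0 half.
by rewrite opprB [u + v]addrC addrACA subrr addr0 half.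
Qed.

Lemma rnorm_le_half_sum (V : normedModType K) (z w : V) :
  2 * rnorm z <= rnorm (z + w) + rnorm (z - w).
Proof.
apply: le_trans (ler_rnormD _ _); rewrite addrACA subrr addr0.
have -> : z + z = scalar_of_real 2 *: z.
  by rewrite scalar_of_realD scalar_of_real1 scalerDl scale1r.
by rewrite rnormZ_real ger0_norm.
Qed.

(** For [w] in the subspace this is [CWO_B_midpoint], with [z] half the sum of the
two points whose half difference is [w]. In general [w] is a weak-star limit of
such vectors by Goldstine's theorem, and [z] is a limit of the corresponding
midpoints. *)
Lemma CWO_B_bidual_midpoint (p : W) (b : dual X) (c : R) :
  CWO_B W -> rnorm p <= 1 -> c < scalar_Re (b (val p)) ->
  exists H : seq (dual X), exists2 e : R, 0 < e &
    forall w : bidual X, biannihilator N w -> rnorm w <= 1 ->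
      (forall h, h \in H -> `|scalar_Re (w h)| < e) ->
    exists z : bidual X, [/\ biannihilator N z, rnorm (z + w) <= 1,
      rnorm (z - w) <= 1 & c <= scalar_Re (z b)].
Proof.
move=> cwo p1 cp.
have [|H0 [e e0 H0P]] := @CWO_B_midpoint R k W [:: (dual_restrict M b, c)] p cwo.
  by split=> // u; rewrite inE => /eqP->.
have [H HP] := dual_Re_test_seq H0 e0.
have e4 : 0 < e / 4 by rewrite divr_gt0.
exists H, (e / 4) => // w Nw w1 wH.
have [U UU UP] := finite_subsets_ultrafilter (dual X).
have FU : ProperFilter U by exact: ultra_proper.
pose Q (i : seq (dual X) * nat) (t : W * W) := [/\
  forall f, f \in i.1 -> `|scalar_Re (f (val t.1)) - scalar_Re (w f)| <= i.2.+1%:R^-1,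
  rnorm (t.2 + t.1) <= 1, rnorm (t.2 - t.1) <= 1 & c <= scalar_Re (b (val t.2))].
have [t tP] : {t : seq (dual X) * nat -> W * W & forall i, Q i (t i)}.
  apply: (@choice _ _ Q) => i.
  pose d : R := Num.min (i.2.+1%:R^-1) (e / 4).
  have d0 : 0 < d by rewrite lt_min invr_gt0 ltr0n/= e4.
  have [x [xN x1 xw]] := goldstine (i.1 ++ H) (subspace_set_submod M) Nw ltr01 w1 d0.
  pose x' : W := Sub x xN.
  have x'E : val x' = x by rewrite SubK.
  have [||u [v [[u1 uL] [v1 vL] xE]]] := H0P x'.
  - by rewrite -rnorm_val x'E.
  - apply: HP => f fH; rewrite x'E.
    have := xw f; rewrite mem_cat fH orbT lt_min => /(_ isT)/andP[_ h1].
    have h2 := wH f fH.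
    have := ler_normD (scalar_Re (f x) - scalar_Re (w f)) (scalar_Re (w f)).
    by rewrite subrK => h3; lra.
  have [zD zB] := midpoint_add u v.
  exists (x', 2^-1 *: (u + v)); split=> /=.
  - move=> f fi; apply/ltW.
    by have := xw f; rewrite mem_cat fi lt_min => /(_ isT)/andP[].
  - by rewrite xE zD.
  - by rewrite xE zB.
  - have hu : c < scalar_Re (dual_restrict M b u) := uL _ (mem_head _ _).
    have hv : c < scalar_Re (dual_restrict M b v) := vL _ (mem_head _ _).
    apply/ltW; change (c < scalar_Re (dual_restrict M b (2^-1 *: (u + v)))).
    by rewrite dual_Re_half dualD scalar_ReD; lra.
pose xs i := canonical_embedding (val (t i).1).
pose zs i := canonical_embedding (val (t i).2).
have xsw : weak_star_cvg U xs w.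
  apply: (@weak_star_cvg_approx _ _ _ _ _ _ (fun=> 1)) => // i f fi.
  by rewrite mul1r; have [h _ _ _] := tP i; exact: h.
have z1 i : rnorm (zs i) <= 1.
  apply: le_trans (rnorm_canonical _) _; rewrite rnorm_val.
  have [_ h1 h2 _] := tP i; have := rnorm_le_half_sum (t i).2 (t i).1.
  by move: h1 h2 => *; lra.
have [z _ zsz] := ultrafilter_weak_star_cvg UU ler01 z1.
exists z; split.
- apply: (biannihilator_lim FU zsz) => i; apply: biannihilator_canonical.
  exact: (valP (t i).2).
- apply: (weak_star_cvg_rnorm FU (weak_star_cvgD _ zsz xsw)) => i.
  have [_ h _ _] := tP i; apply: le_trans h.
  by rewrite /xs /zs -canonical_embeddingD; exact: rnorm_canonical.
- apply: (weak_star_cvg_rnorm FU (weak_star_cvgD _ zsz (weak_star_cvgN _ xsw))) => i.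
  have [_ _ h _] := tP i; apply: le_trans h.
  by rewrite /xs /zs -canonical_embeddingB; exact: rnorm_canonical.
- apply: (weak_star_cvg_ge FU zsz); apply: (@filterE _ U) => i /=.
  by have [_ _ _] := tP i.
Qed.

End MidpointsInBidual.

(** * Approximation of a translate of the bidual of a subspace *)

Section Translate.
Context (R : realType) (k : scalar_kind).
Local Notation K := (scalars R k).
Context (X : normedModType K) (M : submodClosed X).
Local Notation N := ([set x : X | x \in M]).

Lemma subspace_set_add_line (y : X) :
  subspace_set [set x | exists a, exists2 m, m \in M & x = m - a *: y].
Proof.
split; first by exists 0, 0; rewrite ?rpred0// scale0r subrr.
move=> c _ _ [a [m mM ->]] [b [n nM ->]].
exists (c * a + b), (c *: m + n); first by rewrite rpredD// rpredZ.
by rewrite scalerBr scalerDl scalerA opprD addrACA.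
Qed.

(** If [y + s] belongs to the bidual of [M], then [s] is approximated by elements
of [M - y] whose norm is hardly larger than that of [s]. Goldstine's theorem
applied to [s] in [M + K y] gives vectors [m - a y]; testing them also on a
functional which vanishes on [M] but not at [y] forces [a] to be close to [1]. *)
Lemma goldstine_translate (s : bidual X) (y : X) (G : seq (dual X)) (e : R) :
  closed N -> rnorm s <= 1 -> biannihilator N (canonical_embedding y + s) -> 0 < e ->
  exists x, [/\ x \in M, rnorm (x - y) <= 1 + e &
    forall f, f \in G -> `|scalar_Re (f (x - y)) - scalar_Re (s f)| < e].
Proof.
move=> cN s1 Ns e0; have [yM|yM] := boolP (y \in M).
  have Ns' : biannihilator N s.
    have -> : s = (canonical_embedding y + s) - canonical_embedding y.
      by rewrite addrC addKr.
    apply: biannihilatorD => //; apply: biannihilatorN.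
    exact: biannihilator_canonical.
  have [n [nN n1 nG]] := goldstine G (subspace_set_submod M) Ns' ltr01 s1 e0.
  exists (n + y); rewrite addrK; split=> //; first exact: rpredD.
  by apply: le_trans n1 _; rewrite lerDl ltW.
have [d d0 dN] := closed_subspace_dist cN yM.
have [g0 [_ g0N g0y]] := hahn_banach_separation (subspace_set_submod M) (ltW d0) dN.
have g0y0 : g0 y != 0.
  by apply/eqP => h; move: g0y; rewrite h scalar_Re0 leNgt d0.
pose g := - (g0 y)^-1 *: g0.
have gN m : m \in M -> g m = 0 by move=> mM; rewrite dual_scaleE (g0N m mM) mulr0.
have gy : g y = -1 by rewrite dual_scaleE mulNr mulVf.
have sg : s g = 1.
  have : (canonical_embedding y + s) g = 0 by apply: Ns => m; exact: gN.
  rewrite dual_addE [canonical_embedding y g]gy => h.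
  by apply/eqP; rewrite -subr_eq0 addrC; apply/eqP.
pose N' : set X := [set x | exists a, exists2 m, m \in M & x = m - a *: y].
have N's : biannihilator N' s.
  have -> : s = (canonical_embedding y + s) - canonical_embedding y.
    by rewrite addrC addKr.
  apply: biannihilatorD.
    apply: biannihilatorS Ns => m mM; exists 0, m => //.
    by rewrite scale0r subr0.
  apply: biannihilatorN; apply: biannihilator_canonical.
  by exists (-1), 0; rewrite ?rpred0// scaleN1r opprK add0r.
have [j jP] := scalar_rnorm_le R k.
pose B : R := \sum_(f <- G) rnorm f.
have BG f : f \in G -> rnorm f <= B.
  move=> fG; rewrite /B (big_rem f)//= lerDl.
  by apply: sumr_ge0 => h _; exact: rnorm_ge0.
have B0 : 0 <= B by apply: sumr_ge0 => f _; exact: rnorm_ge0.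
pose D : R := 2 * (rnorm y + 1) * (B + 1).
have ny0 := rnorm_ge0 y.
have D0 : 0 < D by rewrite /D !mulr_gt0//; lra.
pose e' := Num.min (e / 2) (e / 2 / D).
have e'0 : 0 < e' by rewrite lt_min !divr_gt0.
have [_ [[a [m mM ->]] n1 nG]] :=
  goldstine [:: g, j *: g & G] (subspace_set_add_line y) N's ltr01 s1 e'0.
have e'1 : e' <= e / 2 by rewrite ge_min lexx.
have e'2 : e' * D <= e / 2 by rewrite -ler_pdivlMr// ge_min lexx orbT.
(* the coefficient [a] is close to [1] *)
have a1 : rnorm (a - 1 : K^o) <= 2 * e'.
  have ga : g (m - a *: y) = a.
    rewrite dualB dualZ gN// gy sub0r; change (- (a * -1 : K) = a).
    by rewrite mulrN1 opprK.
  apply: le_trans (jP _) _.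
  have h1 := nG g (mem_head _ _).
  have h2 : `|scalar_Re (j * a) - scalar_Re (j * 1)| < e'.
    have := nG (j *: g); rewrite !inE eqxx orbT => /(_ isT).
    by rewrite dual_scaleE dualZ ga sg.
  move: h1; rewrite ga sg scalar_ReB mulrBr scalar_ReB => h1.
  by apply/ltW; rewrite mulr_natl mulr2n ltrD.
have mE : m - y = (m - a *: y) + (a - 1) *: y.
  by rewrite scalerBl scale1r addrA subrK.
have ay : rnorm ((a - 1) *: y) * (B + 1) <= e / 2.
  apply: le_trans e'2; rewrite /D mulrA ler_wpM2r//; first lra.
  rewrite rnormZ -[scalar_Re _]/(rnorm (a - 1 : K^o)).
  apply: le_trans (_ : 2 * e' * rnorm y <= _); first by rewrite ler_wpM2r.
  by rewrite mulrA [e' * 2]mulrC ler_wpM2l ?lerDl// mulr_ge0 // ltW.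
have nay := rnorm_ge0 ((a - 1) *: y).
exists m; split=> //.
  rewrite mE; apply: le_trans (ler_rnormD _ _) _; apply: lerD => //.
  by nra.
move=> f fG; rewrite mE dualD scalar_ReD addrAC.
apply: le_lt_trans (ler_normD _ _) _; rewrite [ltRHS]splitr.
apply: ltr_leD.
  by apply: lt_le_trans e'1; apply: nG; rewrite !inE fG !orbT.
have le z : scalar_Re (f z) <= B * rnorm z.
  by apply: le_trans (ler_Re_dual _ _) _; rewrite ler_wpM2r ?rnorm_ge0 ?BG.
rewrite ler_norml lerNl -scalar_ReN -dualN.
have h1 := le ((a - 1) *: y); have := le (- ((a - 1) *: y)); rewrite rnormN => h2.
by apply/andP; split; nra.
Qed.

End Translate.


(** * Singular elements in the bidual of a subspace *)

Section LEmbedded.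
Context (R : realType) (k : scalar_kind).
Local Notation K := (scalars R k).
Context (X : normedModType K) (M : submodClosed X).
Local Notation W := (linear_subspace M).
Local Notation N := ([set x : X | x \in M]).
Context (P : {linear bidual X -> bidual X}).
Hypotheses (PP : forall phi, P (P phi) = P phi)
  (rangeP : range P = range (@canonical_embedding R k X))
  (normP : forall phi, `|phi| = `|P phi| + `|phi - P phi|).

Lemma L_projectionD a b : P (a + b) = P a + P b.
Proof. exact: raddfD. Qed.

Lemma L_projectionZ a b : P (a *: b) = a *: P b.
Proof. exact: linearZ. Qed.

Lemma L_projection_canonical x : P (canonical_embedding x) = canonical_embedding x.
Proof.
have : range (@canonical_embedding R k X) (canonical_embedding x) by exists x.
by rewrite -rangeP => -[phi _ <-]; exact: PP.
Qed.

(** For [X = L1], with its bidual seen as a space of finitely additive measures,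
these are the purely finitely additive ones. *)
Definition singular phi := P phi = 0.

Lemma singularD phi psi : singular phi -> singular psi -> singular (phi + psi).
Proof. by rewrite /singular => h1 h2; rewrite L_projectionD h1 h2 addr0. Qed.

Lemma singularZ a phi : singular phi -> singular (a *: phi).
Proof. by rewrite /singular => h; rewrite L_projectionZ h scaler0. Qed.

Lemma singularN phi : singular phi -> singular (- phi).
Proof. by move=> h; rewrite -scaleN1r; exact: singularZ. Qed.

Lemma L_decomposition phi : exists x t, singular t /\ phi = canonical_embedding x + t.
Proof.
have : range P (P phi) by exists phi.
rewrite rangeP => -[x _ xE]; exists x, (phi - P phi).
split; last by rewrite xE addrC subrK.
by rewrite /singular L_projectionD -scaleN1r L_projectionZ scaleN1r PP subrr.
Qed.

Lemma rnorm_L_sum x t : singular t ->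
  rnorm (canonical_embedding x + t) = rnorm (canonical_embedding x) + rnorm t.
Proof.
move=> t0; have E : P (canonical_embedding x + t) = canonical_embedding x.
  by rewrite L_projectionD t0 addr0 L_projection_canonical.
by rewrite /rnorm normP E ge0_scalar_ReD// [_ + t]addrC addrK.
Qed.

(** Changing the sign of the regular part of [w] does not increase the sum of the
norms of [z + w] and [z - w]: both sums split along the L-decomposition, and only
the pairing of their four terms changes. *)
Lemma rnorm_L_swap z e s a : singular s ->
  rnorm (z + a *: (canonical_embedding e + s)) +
  rnorm (z - a *: (canonical_embedding e + s)) <=
  rnorm (z + a *: (s - canonical_embedding e)) +
  rnorm (z - a *: (s - canonical_embedding e)).
Proof.
move=> s0; have [x [t [t0 ->]]] := L_decomposition z.
have S0 : singular (a *: s) by exact: singularZ.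
rewrite scalerDr scalerBr -!canonical_embeddingZ; move: (a *: s) S0 => S S0.
have tS := singularD t0 S0; have tNS := singularD t0 (singularN S0).
have pair1 (Z : zmodType) (p q r u : Z) : p + q + (r + u) = p + r + (q + u) := addrACA p q r u.
have pair2 (Z : zmodType) (p q r u : Z) : p + q - (r + u) = p - r + (q - u).
  by rewrite opprD addrACA.
have pair3 (Z : zmodType) (p q r u : Z) : p + q + (u - r) = p - r + (q + u).
  by rewrite [u - r]addrC addrACA.
have pair4 (Z : zmodType) (p q r u : Z) : p + q - (u - r) = p + r + (q - u).
  by rewrite opprB addrACA.
rewrite (pair1 _ (canonical_embedding x) t (canonical_embedding (a *: e)) S).
rewrite (pair2 _ (canonical_embedding x) t (canonical_embedding (a *: e)) S).
rewrite (pair3 _ (canonical_embedding x) t (canonical_embedding (a *: e)) S).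
rewrite (pair4 _ (canonical_embedding x) t (canonical_embedding (a *: e)) S).
rewrite -canonical_embeddingD -canonical_embeddingB.
rewrite !rnorm_L_sum// addrACA [leRHS]addrACA.
have := ler_rnormD (canonical_embedding (x + a *: e)) (t + S).
have := ler_rnormD (canonical_embedding (x - a *: e)) (t - S).
by move=> *; lra.
Qed.

(** The regular part [r] of [z] contributes [2 |r|] to the sum, and the singular
parts of [z + s] and [z - s] contribute at least [2 |s| = 2]. *)
Lemma singular_of_flip z s : singular s -> rnorm s = 1 ->
  rnorm (z + s) + rnorm (z - s) <= 2 -> singular z.
Proof.
move=> s0 s1; have [x [t [t0 ->]]] := L_decomposition z.
have tS := singularD t0 s0; have tNS := singularD t0 (singularN s0).
rewrite -!addrA !rnorm_L_sum// => h.
have := rnorm_le_half_sum s t; rewrite s1 [s + t]addrC -[rnorm (s - t)]rnormN opprB => h1.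
have x0 := rnorm_ge0 (canonical_embedding x).
have /rnorm0_eq0-> : rnorm (canonical_embedding x) = 0 by lra.
by rewrite add0r.
Qed.

(** The key step. Let [s] be singular of norm [1] with [y + s] in the bidual of
[M], and let [e] in [M - y] be close to [s] for the weak-star topology, of norm
close to [1]. Half of [s - e] is then a small vector of the bidual of [M], so
there is [z] close to [p] with [z + (s - e) / 2] and [z - (s - e) / 2] in the unit
ball. After the change of sign, the norms of [z + (s + e) / 2] and
[z - (s + e) / 2] have sum at most [2], and [e] tends to [s]. *)
Lemma singular_flip (p : W) (b : dual X) (c : R) (s : bidual X) (y : X) :
  closed N -> CWO_B W -> rnorm p <= 1 -> c < scalar_Re (b (val p)) ->
  singular s -> rnorm s = 1 -> biannihilator N (canonical_embedding y + s) ->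
  exists z, [/\ biannihilator N z, singular z,
    rnorm (z + s) + rnorm (z - s) <= 2 & c <= scalar_Re (z b)].
Proof.
move=> cN cwo p1 cp s0 s1 Ns.
have [H [eta eta0 HP]] := CWO_B_bidual_midpoint cwo p1 cp.
have [U UU UP] := finite_subsets_ultrafilter (dual X).
have FU : ProperFilter U by exact: ultra_proper.
pose d n : R := n.+1%:R^-1.
have d0 n : 0 < d n by rewrite invr_gt0 ltr0n.
pose r n : R := (2 + d n)^-1.
have r0 n : 0 < r n by rewrite invr_gt0 addr_gt0.
have rd n : r n * (2 + d n) = 1 by rewrite mulVf// gt_eqF// addr_gt0.
pose kappa n : K := scalar_of_real (r n).
pose Q (i : seq (dual X) * nat) (t : X * bidual X) := [/\
  (forall f, f \in i.1 -> `|scalar_Re (f t.1) - scalar_Re (s f)| < d i.2),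
  biannihilator N t.2, rnorm t.2 <= 1, c <= scalar_Re (t.2 b) &
  rnorm (t.2 + kappa i.2 *: (canonical_embedding t.1 + s)) +
  rnorm (t.2 - kappa i.2 *: (canonical_embedding t.1 + s)) <= 2].
have [t tP] : {t : seq (dual X) * nat -> X * bidual X & forall i, Q i (t i)}.
  apply: (@choice _ _ Q) => i; set n := i.2; have dn := d0 n; have rn := r0 n; have rdn := rd n.
  have m0 : 0 < Num.min (d n) eta by rewrite lt_min dn.
  have s1' : rnorm s <= 1 by rewrite s1.
  have [x [xM ex eH]] := goldstine_translate (i.1 ++ H) cN s1' Ns m0.
  set e := x - y in ex eH.
  have Nw : biannihilator N (kappa n *: (s - canonical_embedding e)).
    apply: biannihilatorZ.
    have -> : s - canonical_embedding e =
        (canonical_embedding y + s) - canonical_embedding x.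
      by rewrite canonical_embeddingB opprB addrA [s + _]addrC.
    by apply: biannihilatorD => //; apply: biannihilatorN; exact: biannihilator_canonical.
  have [||z [Nz zw1 zw2 cz]] := HP _ Nw.
  - rewrite rnormZ_real gtr0_norm//.
    have h1 := ler_rnormB s (canonical_embedding e).
    have h2 := rnorm_canonical e.
    have h3 : Num.min (d n) eta <= d n by rewrite ge_min lexx.
    rewrite -rdn ler_wpM2l ?(ltW rn)//; lra.
  - move=> h hH; rewrite dual_scaleE scalar_ReZ normrM gtr0_norm//.
    rewrite dual_addE dual_oppE scalar_ReB distrC.
    have := eH h; rewrite mem_cat hH orbT lt_min => /(_ isT)/andP[_].
    rewrite -[canonical_embedding e h]/(h e).
    have := normr_ge0 (scalar_Re (h e) - scalar_Re (s h)).
    move: (`|_ - _|) => v v0 ve; apply: le_lt_trans ve; nra.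
  exists (e, z); split=> //=.
  - by move=> f fi; have := eH f; rewrite mem_cat fi lt_min => /(_ isT)/andP[].
  - by have := rnorm_le_half_sum z (kappa n *: (s - canonical_embedding e)); lra.
  - by apply: le_trans (rnorm_L_swap _ _ _ s0) _; lra.
pose es i := kappa i.2 *: (canonical_embedding (t i).1 + s).
have ess : weak_star_cvg U es s.
  apply: (@weak_star_cvg_approx _ _ _ _ _ _ (fun f => 1 + `|scalar_Re (s f)|)) => // i f fi.
  have [/(_ f fi) h _ _ _ _] := tP i.
  rewrite /es dual_scaleE dual_addE scalar_ReZ scalar_ReD.
  rewrite -[canonical_embedding _ f]/(f (t i).1) -/(d i.2).
  move: h (d0 i.2) (r0 i.2) (rd i.2).
  move: (d _) (r _) (scalar_Re (f _)) (scalar_Re (s f)) => dn rn v u h dn0 rn0 rdn.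
  have -> : rn * (v + u) - u = rn * ((v - u) - dn * u).
    rewrite -[X in _ - X]mul1r -rdn; ring.
  rewrite normrM gtr0_norm//.
  have h1 : `|v - u - dn * u| <= dn * (1 + `|u|).
    apply: le_trans (ler_normB _ _) _; rewrite normrM (gtr0_norm dn0); lra.
  have h2 : rn <= 1 by nra.
  rewrite [leRHS]mulrC; apply: le_trans h1.
  by rewrite ler_piMl.
have z1 i : rnorm (t i).2 <= 1 by have [] := tP i.
have [z _ zz] := ultrafilter_weak_star_cvg UU ler01 z1.
have zs : rnorm (z + s) + rnorm (z - s) <= 2.
  apply: (weak_star_cvg_rnorm2 FU (weak_star_cvgD _ zz ess)
    (weak_star_cvgD _ zz (weak_star_cvgN _ ess))) => i.
  by have [] := tP i.
exists z; split=> //.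
- by apply: (biannihilator_lim FU zz) => i; have [] := tP i.
- exact: singular_of_flip s0 s1 zs.
- by apply: (weak_star_cvg_ge FU zz); apply: (@filterE _ U) => i /=; have [] := tP i.
Qed.

End LEmbedded.

(** [singular_flip] is used twice: it brings a singular vector close to norming [a],
then, from this vector, another one close to norming [b]. This is too much for the
pair [a], [b] given by [dual_pair]. *)
Theorem L_embedded_subspace_not_CWO_B (R : realType) (k : scalar_kind)
    (X : normedModType (scalars R k)) (M : submodClosed X) :
  L_embedded X -> closed [set x : X | x \in M] ->
  infinite_dimensional (linear_subspace M) -> ~ CWO_B (linear_subspace M).
Proof.
move=> [P [PP rangeP normP]] cM iM cwo.
have [a [b [C [abC abC' Cab]]]] := dual_pair iM.
have [A AE] := dual_extend a; have [B BE] := dual_extend b.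
pose d := (rnorm a + rnorm b - C) / 4.
have d0 : 0 < d by rewrite divr_gt0// subr_gt0.
have na0 := rnorm_ge0 a; have nb0 := rnorm_ge0 b.
have d4 : 4 * d = rnorm a + rnorm b - C by rewrite mulrC divfK// pnatr_eq0.
have aC : 2 * rnorm a <= 2 * C by have := rnorm_le_half_sum a b; lra.
have bC : 2 * rnorm b <= 2 * C.
  have := rnorm_le_half_sum b a.
  by rewrite [b + a]addrC -[rnorm (b - a)]rnormN opprB; lra.
have [p p1 pa] := dual_approx_norm a d0; have [q q1 qb] := dual_approx_norm b d0.
rewrite -AE in pa; rewrite -BE in qb.
(* a first singular vector, in the bidual of [M] up to a translation *)
have [psi Mpsi psix] := biannihilator_nonreflexive cM iM cwo.
have [y [s0 [ss0 psiE]]] := L_decomposition PP rangeP psi.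
have s0n0 : s0 != 0.
  by apply/eqP => h; apply: (psix y); rewrite psiE h addr0.
pose t : scalars R k := scalar_of_real (rnorm s0)^-1.
have [|||s [Ms ss sle As]] := @singular_flip R k X M P PP rangeP normP p A
    (rnorm a - d) (t *: s0) (t *: y) cM cwo p1 pa.
- exact: singularZ.
- exact: rnorm1_normalize.
- by rewrite canonical_embeddingZ -scalerDr -psiE; exact: biannihilatorZ.
(* the same, without translation, in the unit sphere and close to norming [a] *)
have a_d : d < rnorm a by lra.
have s_n0 : s != 0.
  apply/eqP => h; move: As; rewrite h -[(0 : bidual X) A]/(0 : scalars R k) scalar_Re0.
  by rewrite subr_le0 leNgt a_d.
have s1 := rnorm1_normalize s_n0.
have s_le1 : rnorm s <= 1.
  by have := rnorm_le_half_sum s (t *: s0); lra.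
set s' := scalar_of_real (rnorm s)^-1 *: s in s1.
have As' : rnorm a - d <= scalar_Re (s' A).
  rewrite dual_scaleE scalar_ReZ ler_pdivlMl; last first.
    by rewrite lt_neqAle rnorm_ge0 andbT eq_sym; apply: contra s_n0 => /eqP/rnorm0_eq0->.
  by apply: le_trans As; rewrite ler_piMl// subr_ge0 ltW.
have [|||z [Mz _ zle Bz]] := @singular_flip R k X M P PP rangeP normP q B
    (rnorm b - d) s' 0 cM cwo q1 qb.
- exact: singularZ.
- exact: s1.
- rewrite -[0](subrr (0 : X)) canonical_embeddingB subrr add0r.
  exact: biannihilatorZ.
have Ms' : biannihilator [set x : X | x \in M] s' by exact: biannihilatorZ.
have sM := subspace_set_submod M; have C0 : 0 <= C by exact: le_trans (rnorm_ge0 _) abC.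
have h1 : scalar_Re ((z + s') (A + B)) <= C * rnorm (z + s').
  apply: (biannihilator_bound sM) => // [|x xM]; first exact: biannihilatorD.
  pose x' : linear_subspace M := Sub x xM.
  have -> : (A + B) x = (a + b) x' by rewrite !dual_addE -AE -BE SubK.
  by apply: le_trans (ler_Re_dual _ _) _; rewrite -rnorm_val SubK ler_wpM2r// rnorm_ge0.
have h2 : scalar_Re ((z - s') (B - A)) <= C * rnorm (z - s').
  apply: (biannihilator_bound sM) => // [|x xM].
    by apply: biannihilatorD => //; exact: biannihilatorN.
  pose x' : linear_subspace M := Sub x xM.
  have -> : (B - A) x = (b - a) x' by rewrite !dual_addE !dual_oppE -AE -BE SubK.
  apply: le_trans (ler_Re_dual _ _) _.
  by rewrite -rnorm_val SubK ler_wpM2r ?rnorm_ge0// -rnormN opprB.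
have h3 : C * (rnorm (z + s') + rnorm (z - s')) <= C * 2 by rewrite ler_wpM2l.
move: h1 h2; rewrite !dual_addE !dual_oppE !(dualD z) !(dualD s') !(dualN z) !(dualN s').
rewrite !(scalar_ReD, scalar_ReN) => h1 h2.
suff : d < d by rewrite ltxx.
lra.
Qed.

(** * [l1]-sums and the space [L1[0, 1]] *)

(** Let [V] be the [l1]-sum of the range and the kernel of [Q]. If [z] is close to a
unit vector [p] of the range and [w] is a unit vector of the kernel, then [z + w]
and [z - w] are not both in the unit ball: the sum of their norms is at least
[2 (|Q z| + |w|)]. *)
Lemma l1_sum_not_CWO_B (R : realType) (k : scalar_kind)
    (V : normedModType (scalars R k)) (Q : V -> V) (p : V) :
  (forall a x y, Q (a *: x + y) = a *: Q x + Q y) -> (forall x, Q (Q x) = Q x) ->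
  (forall x, rnorm x = rnorm (Q x) + rnorm (x - Q x)) ->
  Q p = p -> p != 0 ->
  (forall H : seq (dual V), exists w,
    [/\ rnorm w = 1, Q w = 0 & forall h, h \in H -> h w = 0]) ->
  ~ CWO_B V.
Proof.
move=> QP QQ Qn Qp p0 Qw cwo.
have Q0 : Q 0 = 0 by have := QP (-1) 0 0; rewrite scaler0 addr0 scaleN1r addNr.
have QB x y : Q (x - y) = Q x - Q y.
  by have := QP (-1) y x; rewrite !scaleN1r [- y + x]addrC [- Q y + Q x]addrC.
pose p1 := scalar_of_real (rnorm p)^-1 *: p.
have np1 : rnorm p1 = 1 := rnorm1_normalize p0.
have Qp1 : Q p1 = p1 by have := QP (scalar_of_real (rnorm p)^-1) p 0; rewrite Q0 !addr0 Qp.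
pose N := [set x | Q x = 0].
have sN : subspace_set N.
  split=> [|a x y Nx Ny]; first exact: Q0.
  by rewrite /N /= QP Nx Ny scaler0 addr0.
have [|f [f1 fN fp]] := @hahn_banach_separation R k V N p1 1 sN ler01.
  by move=> n Nn; rewrite Qn QB Qp1 Nn subr0 np1 lerDl rnorm_ge0.
have [|H [e e0 HP]] := @CWO_B_midpoint R k V [:: (f, 2^-1)] p1 cwo.
  split; first by rewrite np1.
  by move=> u; rewrite inE => /eqP->; apply: lt_le_trans fp; rewrite invf_lt1 ?ltr1n.
have [w [w1 Nw wH]] := Qw H.
have [||u [v [[u1 uL] [v1 vL] wE]]] := HP w.
- by rewrite w1.
- by move=> h hH; rewrite wH// rnorm0.
have fu : 2^-1 < scalar_Re (f u) := uL _ (mem_head _ _).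
have fv : 2^-1 < scalar_Re (f v) := vL _ (mem_head _ _).
have [] := midpoint_add u v; rewrite -wE; set z := 2^-1 *: (u + v) => zu zv.
have fz : 2^-1 < scalar_Re (f z).
  by rewrite dual_Re_half dualD scalar_ReD; lra.
have fQ : scalar_Re (f z) <= rnorm (Q z).
  have -> : f z = f (Q z).
    apply/eqP; rewrite -subr_eq0 -dualB; apply/eqP/fN.
    by rewrite /N /= QB QQ subrr.
  by apply: le_trans (ler_Re_dual _ _) _; rewrite ler_piMl ?rnorm_ge0.
have QD : Q (z + w) = Q z by have := QP 1 z w; rewrite !scale1r Nw addr0.
have QS : Q (z - w) = Q z by rewrite QB Nw subr0.
have E1 : z + w - Q z = w + (z - Q z) by rewrite [z + w]addrC addrA.
have E2 : z - w - Q z = - (w - (z - Q z)) by rewrite opprB addrAC.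
have hu := Qn (z + w); rewrite QD E1 zu in hu.
have hv := Qn (z - w); rewrite QS E2 zv rnormN in hv.
have := rnorm_le_half_sum w (z - Q z); rewrite w1 => h.
suff : (2^-1 : R) < 2^-1 by rewrite ltxx.
lra.
Qed.

Section L1.
Context (R : realType) (k : scalar_kind).
Local Notation K := (scalars R k).
Local Notation mu := (@lebesgue_measure R).
Local Notation I01 := (`[0, 1]%classic : set R).
Implicit Types (f g : L1_function R k) (A : set R) (a b : R).

Lemma scalar_ImZ (x : R) (z : K) : scalar_Im (scalar_of_real x * z) = x * scalar_Im z.
Proof. by move: z; case: k => /= [z|[c d]] /=; rewrite ?mulr0 ?mul0r ?addr0. Qed.

Lemma measurable_I01 : measurable (I01 : set (measurableTypeR R)).
Proof. exact: measurable_itv. Qed.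

Lemma integrable_mask A (g : R -> R) : measurable (A : set (measurableTypeR R)) ->
  mu.-integrable I01 (EFin \o g) ->
  mu.-integrable I01 (EFin \o (fun x => \1_A x * g x)).
Proof.
move=> mA ig; apply: (le_integrable measurable_I01 _ _ ig).
  apply/measurable_EFinP; apply: measurable_funM; first exact: measurable_indic.
  by apply/measurable_EFinP; exact: measurable_int ig.
move=> x _; rewrite /= lee_fin normrM indicE.
by case: (_ \in _); rewrite ?normr1 ?mul1r ?normr0 ?mul0r.
Qed.

Lemma mask_is_L1 A f : measurable (A : set (measurableTypeR R)) ->
  (fun x => scalar_of_real (\1_A x) * f x : K^o) \in @is_L1 R k.
Proof.
move=> mA; have /andP[fR fI] := valP f; apply/andP; split.
  rewrite (_ : scalar_Re \o _ = fun x => \1_A x * scalar_Re (f x)).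
    exact: integrable_mask.
  by apply/funext => x; exact: scalar_ReZ.
rewrite (_ : scalar_Im \o _ = fun x => \1_A x * scalar_Im (f x)).
  exact: integrable_mask.
by apply/funext => x; exact: scalar_ImZ.
Qed.

Section Mask.
Context (A : set R) (mA : measurable (A : set (measurableTypeR R))).

Definition L1_mask f : L1_function R k := L1Function (mask_is_L1 f mA).

Definition L1_restrict (u : L1_01 R k) : L1_01 R k := L1_class (L1_mask (repr u)).

Lemma L1_maskE f x : L1_mask f x = scalar_of_real (\1_A x) * f x.
Proof. by []. Qed.

Lemma L1_restrict_class f : L1_restrict (L1_class f) = L1_class (L1_mask f).
Proof.
apply/L1_classP; apply: filterS (repr_L1_class f) => x + xI => /(_ xI) fx.
by rewrite !L1_maskE fx.
Qed.

Lemma L1_restrictP c u v : L1_restrict (c *: u + v) = c *: L1_restrict u + L1_restrict v.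
Proof.
rewrite -[u]L1_reprK -[v]L1_reprK.
rewrite -[c *: L1_class (repr u)]L1_classZ -L1_classD !L1_restrict_class.
rewrite -[c *: L1_class _]L1_classZ -L1_classD; congr L1_class.
apply/val_inj/funext => x.
change (scalar_of_real (\1_A x) * (c * repr u x + repr v x) =
  c * (scalar_of_real (\1_A x) * repr u x) + scalar_of_real (\1_A x) * repr v x :> K).
by rewrite mulrDr mulrCA.
Qed.

Lemma L1_restrict0 : L1_restrict 0 = 0.
Proof.
by have := L1_restrictP (-1) 0 0; rewrite scaler0 addr0 scaleN1r addNr.
Qed.

Lemma rnorm_L1_class f : rnorm (L1_class f) = (\int[mu]_(x in I01) rnorm (f x))%R.
Proof.
rewrite -L1_norm_class /rnorm [`|_|]/(scalar_of_real (L1_norm (L1_class f))).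
exact: scalar_ReK.
Qed.

Lemma rnorm_L1_restrict u : rnorm u = rnorm (L1_restrict u) + rnorm (u - L1_restrict u).
Proof.
rewrite -[u]L1_reprK; move: (repr u) => f; rewrite L1_restrict_class.
rewrite -[- L1_class _]scaleN1r -[-1 *: L1_class _]L1_classZ -L1_classD.
rewrite !rnorm_L1_class -RintegralD; [|exact: measurable_I01|exact: L1_integrable_rnorm|exact: L1_integrable_rnorm].
apply: eq_Rintegral => x _.
change (rnorm (f x) = rnorm (scalar_of_real (\1_A x) * f x : K^o) +
  rnorm (f x + -1 * (scalar_of_real (\1_A x) * f x) : K^o)).
rewrite indicE; case: (_ \in _); rewrite ?scalar_of_real1 ?scalar_of_real0.
  by rewrite mul1r mulN1r subrr rnorm0 addr0.
by rewrite mul0r mulr0 addr0 rnorm0 add0r.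
Qed.

End Mask.

Lemma L1_mask_sub A B f (mA : measurable (A : set (measurableTypeR R)))
    (mB : measurable (B : set (measurableTypeR R))) : A `<=` B ->
  L1_mask mB (L1_mask mA f) = L1_mask mA f.
Proof.
move=> AB; apply/val_inj/funext => x; rewrite /= mulrA -scalar_of_realM !indicE.
have [xA|xA] := boolP (x \in A); last by rewrite mulr0.
by rewrite (mem_set (AB _ (set_mem xA))) mulr1.
Qed.

Lemma L1_mask_disjoint A B f (mA : measurable (A : set (measurableTypeR R)))
    (mB : measurable (B : set (measurableTypeR R))) : A `&` B = set0 ->
  L1_mask mB (L1_mask mA f) = 0.
Proof.
move=> AB; apply/val_inj/funext => x; rewrite /= mulrA -scalar_of_realM !indicE.
have [xA|xA] := boolP (x \in A); last by rewrite mulr0 scalar_of_real0 mul0r.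
have [xB|xB] := boolP (x \in B); last by rewrite mul0r scalar_of_real0 mul0r.
have : (A `&` B) x by split; exact: set_mem.
by rewrite AB.
Qed.

Lemma L1_restrict_sub A B u (mA : measurable (A : set (measurableTypeR R)))
    (mB : measurable (B : set (measurableTypeR R))) : A `<=` B ->
  L1_restrict mA u = u -> L1_restrict mB u = u.
Proof.
by move=> AB uA; rewrite -uA -[u]L1_reprK !L1_restrict_class L1_mask_sub.
Qed.

Lemma L1_restrict_disjoint A B u (mA : measurable (A : set (measurableTypeR R)))
    (mB : measurable (B : set (measurableTypeR R))) : A `&` B = set0 ->
  L1_restrict mA u = u -> L1_restrict mB u = 0.
Proof.
move=> AB uA; rewrite -uA -[u]L1_reprK !L1_restrict_class L1_mask_disjoint//.
exact: L1_class0.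
Qed.

Lemma one_is_L1 : (fun=> 1 : K^o) \in @is_L1 R k.
Proof.
have int (c : R) : mu.-integrable I01 (EFin \o (fun=> c)).
  apply: continuous_compact_integrable; first exact: segment_compact.
  by apply: continuous_subspaceT; exact: cst_continuous.
by apply/andP; split; exact: int.
Qed.

Definition L1_one : L1_function R k := L1Function one_is_L1.

Lemma measurable_itvco a b : measurable (`[a, b[%classic : set (measurableTypeR R)).
Proof. exact: measurable_itv. Qed.

Definition L1_itv a b : L1_01 R k := L1_class (L1_mask (measurable_itvco a b) L1_one).

Lemma L1_itv_neq0 a b : 0 <= a -> a < b -> b <= 1 -> L1_itv a b != 0.
Proof.
move=> a0 ab b1; apply/eqP => h.
have : rnorm (L1_itv a b) = b - a.
  rewrite rnorm_L1_class.
  under eq_Rintegral do rewrite L1_maskE mulr1 rnorm_of_real ger0_norm//.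
  rewrite /Rintegral integral_indic; [|exact: measurable_I01|exact: measurable_itvco].
  rewrite setIidl; last first.
    move=> x /=; rewrite !in_itv/= => /andP[ax xb].
    by rewrite (le_trans a0 ax) (le_trans (ltW xb) b1).
  apply: etrans (congr1 fine (lebesgue_measure_itv `[a, b[)) _.
  by rewrite /= lte_fin ab.
by rewrite h rnorm0; lra.
Qed.

(** Halving the interval produces two elements with disjoint supports, and one more
functional can be annihilated by a combination of the two. *)
Lemma L1_itv_kernel (H : seq (dual (L1_01 R k))) a b : 0 <= a -> a < b -> b <= 1 ->
  exists u : L1_01 R k, [/\ u != 0, L1_restrict (measurable_itvco a b) u = u &
    forall h, h \in H -> h u = 0].
Proof.
elim: H a b => [|h H IH] a b a0 ab b1.
  exists (L1_itv a b); split=> //; first exact: L1_itv_neq0.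
  by rewrite L1_restrict_class L1_mask_sub.
pose m := (a + b) / 2.
have am : a < m by rewrite /m; lra.
have mb : m < b by rewrite /m; lra.
have [u [u0 uam uH]] := IH a m a0 am (le_trans (ltW mb) b1).
have [v [v0 vmb vH]] := IH m b (le_trans a0 (ltW am)) mb b1.
have subl : `[a, m[ `<=` `[a, b[.
  by move=> x /=; rewrite !in_itv/= => /andP[-> /lt_trans->].
have subr : `[m, b[ `<=` `[a, b[.
  by move=> x /=; rewrite !in_itv/= => /andP[/(le_trans (ltW am))-> ->].
have disj : `[a, m[ `&` `[m, b[ = set0.
  apply/seteqP; split=> x //=; rewrite !in_itv/= => -[/andP[_ xm] /andP[mx _]].
  by move: (lt_le_trans xm mx); rewrite ltxx.
have uab := L1_restrict_sub (measurable_itvco a b) subl uam.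
have vab := L1_restrict_sub (measurable_itvco a b) subr vmb.
have [hu|hu] := eqVneq (h u) 0.
  by exists u; split=> // g; rewrite inE => /orP[/eqP->//|]; exact: uH.
exists (- (h v / h u) *: u + v); split.
- apply/eqP => w0.
  have := L1_restrictP (measurable_itvco m b) (- (h v / h u)) u v.
  rewrite w0 L1_restrict0 vmb.
  rewrite (L1_restrict_disjoint (measurable_itvco m b) disj uam) scaler0 add0r.
  by move=> v00; move/eqP: v0; apply.
- by rewrite L1_restrictP uab vab.
move=> g; rewrite inE dualD dualZ => /orP[/eqP->|gH].
  change (- (h v / h u) * h u + h v = 0 :> K).
  by rewrite mulNr divfK// addNr.
by rewrite (uH g gH) (vH g gH) scaler0 addr0.
Qed.

Theorem L1_01_not_CWO_B : ~ CWO_B (L1_01 R k).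
Proof.
pose A : set R := `[0, 2^-1[%classic; have mA := measurable_itvco 0 2^-1.
have half0 : (0 : R) < 2^-1 by rewrite invr_gt0.
have half1 : (2^-1 : R) < 1 by rewrite invf_lt1 ?ltr1n.
apply: (@l1_sum_not_CWO_B R k _ (L1_restrict mA) (L1_itv 0 2^-1)).
- exact: L1_restrictP.
- by move=> u; rewrite -[u]L1_reprK !L1_restrict_class L1_mask_sub.
- exact: rnorm_L1_restrict.
- by rewrite L1_restrict_class L1_mask_sub.
- by apply: L1_itv_neq0 => //; exact: ltW.
move=> H; have [u [u0 uB uH]] := L1_itv_kernel H (ltW half0) half1 (lexx 1).
exists (scalar_of_real (rnorm u)^-1 *: u); split.
- exact: rnorm1_normalize.
- have disj : `[(2^-1 : R), 1[ `&` `[0, 2^-1[ = set0.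
    apply/seteqP; split=> x //=; rewrite !in_itv/= => -[/andP[mx _] /andP[_ xm]].
    by move: (lt_le_trans xm mx); rewrite ltxx.
  have uA := L1_restrict_disjoint mA disj uB.
  by rewrite -[_ *: u]addr0 L1_restrictP uA L1_restrict0 scaler0 addr0.
by move=> h hH; rewrite dualZ uH// scaler0.
Qed.

End L1.

Theorem corollary4p6 (R : realType) (k : scalar_kind) :
  (forall (X : completeNormedModType (scalars R k)) (M : submodClosed X),
      L_embedded X ->
      closed [set x : X | x \in M] ->
      infinite_dimensional (linear_subspace M) ->
      ~ CWO_B (linear_subspace M)) /\
  ~ CWO_B (L1_01 R k).
Proof.
split; last exact: L1_01_not_CWO_B.
by move=> X M; exact: L_embedded_subspace_not_CWO_B.
Qed.
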